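(* Fix $d \geq 1$ and distinct integers $r_1, \ldots, r_d \geq 2$. Let $\mathbf H_n = (H_n^{(1)}, \ldots, H_n^{(d)})$, $n\ge1$, be a sequence of $d$-hypermultiplexes, where $H_n^{(i)}$ is $r_i$-uniform for $1 \leq i \leq d$. Suppose the vertices of $\mathbf H_n$ are colored uniformly at random with $c_n$ colors, where $c_n\to\infty$, such that for each $1 \leq i \leq d$, $$\lim_{n \to \infty}\mathbb{E}\,T(H_n^{(i)}) = \lim_{n \to \infty}\mathrm{Var}\,T(H_n^{(i)}) = \lambda_i$$ for some constant $\lambda_i \geq 0$. Then, as $n \to \infty$, $(T(H_n^{(1)}), \ldots, T(H_n^{(d)}))^\top$ converges in distribution to $(Z_1, \ldots, Z_d)^\top$, where $Z_1\sim \mathrm{Pois}(\lambda_1), \ldots, Z_d \sim \mathrm{Pois}(\lambda_d)$ are independent.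
   Context: An $r$-uniform hypergraph $H=(V(H),E(H))$ consists of a finite vertex set $V(H)$ and a set $E(H)$ of $r$-element subsets of $V(H)$, called hyperedges. A $d$-hypermultiplex is a tuple $\mathbf H_n=(H_n^{(1)},\dots,H_n^{(d)})$ of uniform hypergraphs with a common vertex set $V_n$. ''Colored uniformly at random with $c_n$ colors'' means each $v\in V_n$ gets a color $X_v$ uniform on $\{1,\dots,c_n\}$, independently over the vertices (a single coloring is used for all layers). $T(H_n^{(i)})=\sum_{e\in E(H_n^{(i)})}\mathbf 1\{X_v=X_{v'}\ \forall v,v'\in e\}$ is the number of monochromatic hyperedges of $H_n^{(i)}$. $\mathrm{Pois}(0)$ is the point mass at $0$. *)

(* Defs.v *)
(* MathComp and MathComp-Analysis *)
From HB Require Import structures.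
From mathcomp Require Import all_boot all_order all_algebra.
From mathcomp Require Import all_classical all_reals all_analysis.

Set Implicit Arguments.
Unset Strict Implicit.
Unset Printing Implicit Defensive.

Import Order.TTheory GRing.Theory Num.Theory.
Import numFieldNormedType.Exports.

Local Open Scope classical_set_scope.
Local Open Scope ring_scope.

Record uniform_hypergraph (V : finType) (r : nat) := UniformHypergraph {
  hyperedges : {set {set V}};
  card_hyperedges : forall e : {set V}, e \in hyperedges -> #|e| = r
}.

Definition hypermultiplex (V : finType) (d : nat) (r : 'I_d -> nat) :=
  forall i : 'I_d, uniform_hypergraph V (r i).

Definition monochromatic (V : finType) (x : V -> nat) (e : {set V}) : bool :=
  [forall v in e, forall v' in e, x v == x v'].

Definition mutually_independent (R : realType)
    (dO dS : measure_display) (Omega : measurableType dO)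
    (S : measurableType dS) (P : probability Omega R) (I : finType)
    (X : I -> {RV P >-> S}) : Prop :=
  forall (J : {set I}) (B : I -> set S), (forall i, measurable (B i)) ->
    P (\bigcap_(i in [set` J]) (X i @^-1` B i)) =
    (\prod_(i in J) P (X i @^-1` B i))%E.

Definition uniformly_distributed (R : realType) (dO : measure_display)
    (Omega : measurableType dO) (P : probability Omega R) (c : nat)
    (X : {RV P >-> nat}) : Prop :=
  forall k : nat, distribution P X [set k] =
    (if (1 <= k <= c)%N then c%:R^-1 else 0)%:E.

(* A coloring of V with the c colors 1, ..., c, uniformly at random. *)
Definition uniform_random_coloring (R : realType) (dO : measure_display)
    (Omega : measurableType dO) (P : probability Omega R) (V : finType)
    (c : nat) (X : V -> {RV P >-> nat}) : Prop :=
  (forall v, uniformly_distributed c (X v)) /\ mutually_independent X.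

Definition monochromatic_count (R : realType) (dO : measure_display)
    (Omega : measurableType dO) (P : probability Omega R) (V : finType)
    (r : nat) (H : uniform_hypergraph V r) (X : V -> {RV P >-> nat})
    (w : Omega) : R :=
  \sum_(e in hyperedges H) (monochromatic (fun v => X v w) e)%:R.

(* The second argument of poisson_prob is a dummy; when lambda = 0,
   poisson_prob lambda is the Dirac mass at 0. *)
Definition poisson_distributed (R : realType) (dO : measure_display)
    (Omega : measurableType dO) (P : probability Omega R) (lambda : R)
    (Z : {RV P >-> nat}) : Prop :=
  distribution P Z = poisson_prob lambda 0 :> (set nat -> \bar R).

(* The random vectors Y n may live on different probability spaces.  The
   maps Y n and Z are meant to be Borel measurable. *)
Definition cvg_in_distribution (R : realType) (d : nat)
    (dO : nat -> measure_display)
    (Omega : forall n, measurableType (dO n))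
    (P : forall n, probability (Omega n) R)
    (Y : forall n, Omega n -> 'cV[R]_d)
    (dL : measure_display) (OmegaL : measurableType dL)
    (PL : probability OmegaL R) (Z : OmegaL -> 'cV[R]_d) : Prop :=
  forall f : 'cV[R]_d -> R, continuous f -> bounded_fun f ->
    ('E_(P n)[f \o Y n] @[n --> \oo] --> 'E_PL[f \o Z])%E.

(* Main.v *)
Require Import Defs.
From HB Require Import structures.
From mathcomp Require Import all_boot all_order all_algebra.
From mathcomp Require Import ring lra.
From mathcomp Require Import all_classical all_reals all_analysis.

Set Implicit Arguments.
Unset Strict Implicit.
Unset Printing Implicit Defensive.

Import Order.TTheory GRing.Theory Num.Theory.
Import numFieldNormedType.Exports.

Local Open Scope ring_scope.

(** Write [p e = c^(1 - #|e|)] for the probability that [e] is monochromatic.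
For two hyperedges with [s = #|e :&: f|] the probability that both are
monochromatic is [p e * p f * c^(s - 1)], with truncated [s - 1]: pairs with at
most one common vertex are pairwise independent, and the others are positively
correlated by a factor at least [c].  Hence, since [E T] and [Var T] have the
same limit, the sum [A] of these joint probabilities over the pairs of distinct
hyperedges of one layer with at least two common vertices tends to [0]
([variance_ge_overlap]).  The same then holds across two layers: grouping the
pairs by [S = e :&: f], the Cauchy-Schwarz inequality bounds the cross term by
the product of two quantities of the within-layer kind.  The uniformities being
different, [S] is strictly smaller than every hyperedge of the layer of larger
uniformity, so the factor of that layer tends to [0] ([overlap_cross]).

The Poisson limit comes from size biasing.  Recoloring all of [e] with the color
of one of its vertices [u] produces the conditional law given that [e] is
monochromatic ([mean_mono_recolor]).  This coupling changes the status of
another hyperedge [f] only if [f] contains a vertex of [e] other than [u].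
Pairs sharing two vertices contribute at most [A] and a multiple of
[\sum p e * p f].  A hyperedge [f] sharing one vertex [v] with [e] costs
[p e * p f], and such pairs may be too many if [u] is arbitrary: in a star the
center must keep its color.  So [u] is taken to be the vertex of [e] of largest
weight [D u = \sum_(f containing u) p f]; then [D v] is at most
[Num.min (D u) (D v)], and Cauchy-Schwarz bounds the total cost by
[(\sum_(u != v) D2 (u, v)^2)^(1/2) * \sum_u D u], where [D2 (u, v)] is the
weight of the hyperedges containing both vertices; the first factor tends to [0]
because [A] and [\sum (p e)^2] do ([sum_other_vertex_weight]).

Consequently the probabilities [q k] that the count vector equals [k] satisfy
[(k i + 1) * q (k + delta_i) - E T_i * q k --> 0] for all [k] and [i]
([count_pmf_recursion]).  In the limit this recursion determines [q k / q 0],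
and the bounded expectations of the counts prevent mass from escaping, so [q k]
tends to the product of Poisson weights ([pmf_cvg]).  As the limits sum to [1],
pointwise convergence of the probabilities gives convergence of the expectation
of every bounded function ([Rintegral_cvg_atom]). *)

(** * Uniform colorings of a finite vertex set *)

Section Coloring.
Context (R : realType) (V : finType) (c : nat).
Implicit Types (x y : {ffun V -> 'I_c}) (e f : {set V}) (u v : V).
Implicit Types (phi psi : {ffun V -> 'I_c} -> R).

Definition mean phi : R := c%:R ^- #|V| * \sum_x phi x.

Definition mono x e : bool := monochromatic (fun v => (x v).+1) e.

Definition recolor e u x : {ffun V -> 'I_c} :=
  [ffun v => if v \in e then x u else x v].

Definition mono_prob e : R := c%:R ^- #|e|.-1.

Lemma monoP x e u : u \in e ->
  reflect (forall v, v \in e -> x v = x u) (mono x e).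
Proof.
move=> ue; apply: (iffP forall_inP) => [h v ve|h v ve].
  by have /forall_inP/(_ u ue) := h v ve; rewrite eqSS => /eqP/val_inj.
by apply/forall_inP => w we; rewrite h// h.
Qed.

Lemma mono_recolor x e u : u \in e -> mono (recolor e u x) e.
Proof. by move=> ue; apply/(monoP _ ue) => v ve; rewrite !ffunE ve ue. Qed.

Lemma eq_mono x y e : {in e, x =1 y} -> mono x e = mono y e.
Proof.
move=> xy; rewrite /mono /monochromatic; apply: eq_forallb => v.
case: (boolP (v \in e)) => //= ve; apply: eq_forallb => w.
by case: (boolP (w \in e)) => //= we; rewrite !xy.
Qed.

Lemma recolor_mono_same x e f u :
  [disjoint e :\ u & f]%B -> mono (recolor e u x) f = mono x f.
Proof.
move=> /disjoint_setI0 /setP euf; apply: eq_mono => v vf; rewrite ffunE.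
have := euf v; rewrite !inE vf andbT.
by case: eqVneq => [->|_ /= -> //]; rewrite if_same.
Qed.

Lemma mono_setU x e f u : u \in e -> u \in f ->
  mono x (e :|: f) = mono x e && mono x f.
Proof.
move=> ue uf; have uef : u \in e :|: f by rewrite inE ue.
apply/(monoP _ uef)/andP => [h|[/(monoP _ ue) h1 /(monoP _ uf) h2] v].
  by split; [apply/(monoP _ ue) | apply/(monoP _ uf)] => v vef;
    apply: h; rewrite inE vef ?orbT.
by rewrite inE => /orP[/h1|/h2].
Qed.

(** A coloring in which [e] is monochromatic arises by recoloring from exactly
those colorings that agree with it outside [e :\ u]; the colors on [e :\ u] are
free. *)
Lemma card_recolor_fiber e u y : u \in e ->
  #|[set x | recolor e u x == y]| = (mono y e * c ^ #|e|.-1)%N.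
Proof.
move=> ue; case: (boolP (mono y e)) => [/(monoP _ ue) ye|yNe]; last first.
  rewrite mul0n; apply: eq_card0 => x; rewrite inE; apply: contraNF yNe.
  by move=> /eqP <-; exact: mono_recolor.
have -> : #|[set x | recolor e u x == y]| =
    #|(family (fun v => if v \in e :\ u then predT else pred1 (y v))
        : simpl_pred {ffun V -> 'I_c})|.
  apply: eq_card => x; rewrite !inE; apply/eqP/familyP => [xy v|xy].
    rewrite -xy !ffunE !inE; case: (eqVneq v u) => [->|vu] /=.
      by rewrite if_same inE.
    by case: (v \in e); rewrite inE.
  have xyu : x u = y u by have := xy u; rewrite !inE eqxx /= inE => /eqP.
  apply/ffunP => v; rewrite ffunE; have := xy v; rewrite !inE.
  case: (boolP (v \in e)) => ve; first by rewrite ye.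
  by rewrite andbF inE => /eqP.
rewrite card_family foldrE big_map big_enum /= mul1n.
rewrite (eq_bigr (fun v => if v \in e :\ u then c else 1%N)); last first.
  move=> v _; case: ifP => _; first by rewrite card_ord.
  by rewrite card1.
rewrite -big_mkcond /= prod_nat_const; congr (_ ^ _)%N.
by rewrite (cardsD1 u e) ue.
Qed.

Lemma eq_mean phi psi : phi =1 psi -> mean phi = mean psi.
Proof. by move=> h; rewrite /mean; under eq_bigr do rewrite h. Qed.

Lemma meanD phi psi : mean (fun x => phi x + psi x) = mean phi + mean psi.
Proof. by rewrite /mean big_split mulrDr. Qed.

Lemma meanB phi psi : mean (fun x => phi x - psi x) = mean phi - mean psi.
Proof. by rewrite /mean sumrB mulrBr. Qed.

Lemma meanZ a phi : mean (fun x => a * phi x) = a * mean phi.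
Proof. by rewrite /mean -mulr_sumr mulrCA. Qed.

Lemma mean_sum (I : finType) (A : pred I) (phi : I -> {ffun V -> 'I_c} -> R) :
  mean (fun x => \sum_(i | A i) phi i x) = \sum_(i | A i) mean (phi i).
Proof. by rewrite /mean exchange_big mulr_sumr. Qed.

Lemma ler_mean phi psi : (forall x, phi x <= psi x) -> mean phi <= mean psi.
Proof.
by move=> h; apply: ler_wpM2l; rewrite ?invr_ge0 ?exprn_ge0//; exact: ler_sum.
Qed.

Lemma mean_ge0 phi : (forall x, 0 <= phi x) -> 0 <= mean phi.
Proof.
by move=> h; rewrite mulr_ge0 ?invr_ge0 ?exprn_ge0// sumr_ge0.
Qed.

Lemma mean_const a : (0 < c)%N -> mean (fun=> a) = a.
Proof.
move=> c0; rewrite /mean sumr_const card_ffun card_ord -[a *+ _]mulr_natr natrX.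
by rewrite mulrCA mulVf ?mulr1// expf_neq0// pnatr_eq0 -lt0n.
Qed.

Lemma mono_prob_ge0 e : 0 <= mono_prob e.
Proof. by rewrite invr_ge0 exprn_ge0. Qed.

(** Size biasing: as the fibers of [recolor e u] over the colorings with [e]
monochromatic all have the same cardinality, [recolor e u] maps the uniform law
to the uniform law conditioned on [e] being monochromatic. *)
Lemma mean_mono_recolor e u phi : (0 < c)%N -> u \in e ->
  mean (fun x => (mono x e)%:R * phi x) =
  mono_prob e * mean (fun x => phi (recolor e u x)).
Proof.
move=> c0 ue; have c0R : c%:R != 0 :> R by rewrite pnatr_eq0 -lt0n.
rewrite /mean mulrCA; congr (_ * _).
have -> : \sum_x phi (recolor e u x) =
    \sum_y (mono y e * c ^ #|e|.-1)%:R * phi y.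
  rewrite (partition_big (recolor e u) predT)//=; apply: eq_bigr => y _.
  rewrite -(card_recolor_fiber _ ue) (eq_bigr (fun=> phi y)).
    by rewrite sumr_const mulr_natl; congr (_ *+ _); apply: eq_card => x; rewrite inE.
  by move=> x /eqP ->.
rewrite mulr_sumr; apply: eq_bigr => y _.
by rewrite natrM natrX /mono_prob -mulrA [RHS]mulrCA mulKf ?expf_neq0.
Qed.

Lemma mean_mono e : (0 < c)%N -> (0 < #|e|)%N ->
  mean (fun x => (mono x e)%:R) = mono_prob e.
Proof.
move=> c0 /card_gt0P[u ue].
have := mean_mono_recolor (fun=> 1) c0 ue.
by rewrite mean_const// mulr1 => <-; apply: eq_mean => x; rewrite mulr1.
Qed.

(** The truncated predecessor gives the exponent [0] both to disjoint pairs and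
to pairs with exactly one common vertex: in both cases the events are
independent. *)
Definition joint_prob e f : R :=
  mono_prob e * mono_prob f * c%:R ^+ #|e :&: f|.-1.

Lemma joint_prob_ge0 e f : 0 <= joint_prob e f.
Proof. by rewrite !mulr_ge0 ?mono_prob_ge0 ?exprn_ge0. Qed.

Lemma joint_probC e f : joint_prob e f = joint_prob f e.
Proof. by rewrite /joint_prob finset.setIC [mono_prob e * _]mulrC. Qed.

(** For sets with a common vertex, both are monochromatic if and only if their
union is; disjoint sets are handled by recoloring one of them, which does not
affect the other. *)
Lemma mean_mono2 e f : (0 < c)%N -> (0 < #|e|)%N -> (0 < #|f|)%N ->
  mean (fun x => (mono x e)%:R * (mono x f)%:R) = joint_prob e f.
Proof.
move=> c0 e0 f0; have c0R : c%:R != 0 :> R by rewrite pnatr_eq0 -lt0n.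
have [ef0|/card_gt0P[u]] := posnP #|e :&: f|.
  have [u ue] := card_gt0P e0.
  rewrite (mean_mono_recolor (fun x => (mono x f)%:R) c0 ue) /joint_prob ef0.
  rewrite expr0 mulr1 -(mean_mono c0 f0); congr (_ * _); apply: eq_mean => x.
  rewrite recolor_mono_same//.
  apply: (disjointWl (subD1set _ _)).
  by rewrite -setI_eq0 -cards_eq0 ef0.
rewrite inE => /andP[ue uf].
have -> : mean (fun x => (mono x e)%:R * (mono x f)%:R) =
    mean (fun x => (mono x (e :|: f))%:R).
  by apply: eq_mean => x; rewrite (mono_setU _ ue uf) -natrM mulnb.
have ef0 : (0 < #|e :&: f|)%N by apply/card_gt0P; exists u; rewrite inE ue.
have U0 : (0 < #|e :|: f|)%N by apply/card_gt0P; exists u; rewrite inE ue.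
rewrite mean_mono// /joint_prob /mono_prob.
rewrite -invfM -exprD; apply: (canRL (mulKf (expf_neq0 _ c0R))).
apply: (canLR (mulfK (expf_neq0 _ c0R))).
rewrite -exprD; congr (_ ^+ _).
have := cardsUI e f; rewrite -(prednK e0) -(prednK f0) -(prednK U0) -(prednK ef0).
by rewrite !addSn !addnS => -[] <-; rewrite addnC.
Qed.

End Coloring.
(** * Pairs of hyperedges with at least two common vertices *)

(** The difference of the squares of both sides is half of
[\sum_i \sum_j w i * w j * (a i * b j - a j * b i) ^+ 2]. *)
Lemma cauchy_schwarz_sum (R : rcfType) (I : finType) (w a b : I -> R) :
  (forall i, 0 <= w i) ->
  \sum_i w i * (a i * b i) <=
  Num.sqrt (\sum_i w i * a i ^+ 2) * Num.sqrt (\sum_i w i * b i ^+ 2).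
Proof.
move=> w0; set S := \sum_i w i * (a i * b i).
set A := \sum_i w i * a i ^+ 2; set B := \sum_i w i * b i ^+ 2.
have A0 : 0 <= A by rewrite sumr_ge0// => i _; rewrite mulr_ge0 ?sqr_ge0 ?w0.
have B0 : 0 <= B by rewrite sumr_ge0// => i _; rewrite mulr_ge0 ?sqr_ge0 ?w0.
rewrite -sqrtrM//; apply: (le_trans (ler_norm _)); rewrite -sqrtr_sqr ler_wsqrtr//.
have : 0 <= \sum_i \sum_j w i * w j * (a i * b j - a j * b i) ^+ 2.
  by apply: sumr_ge0 => i _; apply: sumr_ge0 => j _;
  exact: mulr_ge0 (mulr_ge0 (w0 _) (w0 _)) (sqr_ge0 _).
have -> : \sum_i \sum_j w i * w j * (a i * b j - a j * b i) ^+ 2 =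
    A * B + B * A - (S * S) *+ 2.
  rewrite /A /B /S !big_distrlr /= -sumrMnl -sumrN -!big_split /=.
  apply: eq_bigr => i _; rewrite -sumrMnl -sumrN -!big_split /=.
  apply: eq_bigr => j _; rewrite mulr2n; ring.
by rewrite [B * A]mulrC -mulr2n -mulrnBl pmulrn_lge0// subr_ge0 expr2.
Qed.

Section Overlap.
Context (R : realType) (V : finType) (c : nat).
Implicit Types (e f S : {set V}) (u v : V) (E F G : {set {set V}}).
Notation p := (@mono_prob R V c).
Notation J := (@joint_prob R V c).

Definition expected_count F : R := \sum_(e in F) p e.

Definition overlap F G : R :=
  \sum_(e in F) \sum_(f in G | (f != e) && (1 < #|e :&: f|)%N) J e f.

Lemma expected_count_ge0 F : 0 <= expected_count F.
Proof. by apply: sumr_ge0 => e _; exact: mono_prob_ge0. Qed.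

Lemma overlap_ge0 F G : 0 <= overlap F G.
Proof.
by apply: sumr_ge0 => e _; apply: sumr_ge0 => f _; exact: joint_prob_ge0.
Qed.

Lemma overlapC F G : overlap F G = overlap G F.
Proof.
rewrite /overlap (exchange_big_dep (mem G))/=; last by move=> e f _ /andP[].
apply: eq_bigr => f fG; apply: eq_big => [e|e _]; last exact: joint_probC.
by rewrite fG /= eq_sym finset.setIC.
Qed.

Hypothesis c1 : (1 < c)%N.

Let c0 : 0 < c%:R :> R. Proof. by rewrite ltr0n ltnW. Qed.
Let c1R : 1 <= c%:R :> R. Proof. by rewrite ler1n ltnW. Qed.

Lemma mono_prob_mulX e k : (k <= #|e|.-1)%N ->
  p e * c%:R ^+ k = c%:R ^- (#|e|.-1 - k).
Proof.
move=> ke; rewrite /mono_prob -{1}(subnK ke) exprD invfM -mulrA mulVf ?mulr1//.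
by rewrite expf_neq0// gt_eqF.
Qed.

Lemma mono_prob_leV e : (1 < #|e|)%N -> p e <= c%:R^-1.
Proof.
case en : #|e| => [|[|n]]// _; rewrite /mono_prob en /= exprS invfM.
by rewrite ler_piMr ?invr_ge0 ?(ltW c0)// invf_le1 ?exprn_gt0// exprn_ege1.
Qed.

Lemma joint_prob_id e : J e e = p e.
Proof.
by rewrite /joint_prob finset.setIid -mulrA mono_prob_mulX// subnn expr0 invr1 mulr1.
Qed.

Lemma mono_prob2_le_joint e f : p e * p f <= J e f.
Proof.
by rewrite /joint_prob ler_peMr ?mulr_ge0 ?mono_prob_ge0// exprn_ege1.
Qed.

Lemma sum_mono_prob_sqr F : (forall e, e \in F -> (1 < #|e|)%N) ->
  \sum_(e in F) p e ^+ 2 <= expected_count F / c%:R.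
Proof.
move=> hF; rewrite /expected_count mulr_suml; apply: ler_sum => e eF.
by rewrite expr2 ler_wpM2l ?mono_prob_ge0// mono_prob_leV// hF.
Qed.

(** All covariances are nonnegative.  The diagonal ones are [p e - p e ^+ 2],
and for two common vertices or more the covariance is at least half of the joint
probability, since the latter exceeds [p e * p f] by a factor at least [c >= 2]. *)
Lemma variance_ge_overlap F : (forall e, e \in F -> (1 < #|e|)%N) ->
  expected_count F - expected_count F / c%:R + overlap F F / 2 <=
  mean (fun x : {ffun V -> 'I_c} =>
    (\sum_(e in F) (mono x e)%:R - expected_count F) ^+ 2).
Proof.
move=> hF; set m := expected_count F.
have hF0 e : e \in F -> (0 < #|e|)%N by move=> /hF/ltnW.
have ET : mean (fun x : {ffun V -> 'I_c} => \sum_(e in F) (mono x e)%:R) = m.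
  rewrite mean_sum; apply: eq_bigr => e eF.
  by rewrite mean_mono ?hF0// ltnW.
have sq t : (t - m) ^+ 2 = t * t + (- (m *+ 2) * t + m ^+ 2).
  by rewrite mulr2n; ring.
(* The right-hand side is the sum of the covariances. *)
rewrite [leRHS](_ : _ = \sum_(e in F) \sum_(f in F) (J e f - p e * p f)); last first.
  rewrite (@eq_mean _ _ _ _ (fun x => \sum_(e in F) \sum_(f in F)
      (mono x e)%:R * (mono x f)%:R
    + ((- (m *+ 2)) * \sum_(e in F) (mono x e)%:R + m ^+ 2))); last first.
    by move=> x; rewrite -big_distrlr /= sq.
  rewrite meanD meanD meanZ ET mean_const; last exact: ltnW.
  rewrite mean_sum (_ : m ^+ 2 = \sum_(e in F) \sum_(f in F) p e * p f); last first.
    by rewrite -big_distrlr.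
  rewrite [RHS](_ : _ = \sum_(e in F) \sum_(f in F) J e f -
      \sum_(e in F) \sum_(f in F) p e * p f); last first.
    by rewrite -sumrB; apply: eq_bigr => e _; rewrite -sumrB.
  congr (_ + _); first apply: eq_bigr => e eF.
    rewrite mean_sum; apply: eq_bigr => f fF; rewrite mean_mono2 ?hF0//.
    exact: ltnW.
  by rewrite -big_distrlr /= -/(expected_count F) -/m mulr2n; ring.
apply: (@le_trans _ _ (\sum_(e in F) ((p e - p e ^+ 2) +
    \sum_(f in F | (f != e) && (1 < #|e :&: f|)%N) J e f / 2))).
  rewrite big_split /= sumrB -/(expected_count F) -/m lerD//.
    by rewrite lerD2l lerN2 sum_mono_prob_sqr.
  rewrite /overlap mulr_suml; apply: ler_sum => e _; by rewrite mulr_suml.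
apply: ler_sum => e eF; rewrite [leRHS](bigD1 e)//= joint_prob_id expr2 lerD2l.
rewrite [leRHS](bigID (fun f => (1 < #|e :&: f|)%N)) /=.
rewrite -[leLHS]addr0 lerD//.
  rewrite [leLHS](eq_bigl (fun f => (f \in F) && (f != e) && (1 < #|e :&: f|)%N)); last first.
    by move=> f; rewrite andbA.
  apply: ler_sum => f /andP[/andP[fF fe] s1].
  suff : p e * p f <= J e f / 2 by lra.
  rewrite /joint_prob -mulrA ler_peMr ?mulr_ge0 ?mono_prob_ge0//.
  rewrite ler_pdivlMr// mul1r; case: #|e :&: f| s1 => [|[|n]]// _.
  rewrite /= exprS -[2]mulr1 ler_pM// ?exprn_ege1//.
  by rewrite ler_nat.
apply: sumr_ge0 => f _; by rewrite subr_ge0 mono_prob2_le_joint.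
Qed.

(** The index [i] stands for a set of vertices included in the hyperedges, or for
a pair of vertices belonging to them. *)
Lemma sum_incidence (I : finType) (w : I -> R) (inc : I -> {set V} -> bool) F G :
  \sum_i w i * ((\sum_(e in F | inc i e) p e) * (\sum_(f in G | inc i f) p f)) =
  \sum_(e in F) \sum_(f in G) p e * p f * \sum_(i | inc i e && inc i f) w i.
Proof.
transitivity (\sum_i \sum_(e in F) \sum_(f in G)
    (if inc i e && inc i f then p e * p f * w i else 0)).
  apply: eq_bigr => i _; rewrite big_distrlr /= mulr_sumr.
  rewrite big_mkcondr /=; apply: eq_bigr => e eF.
  case: (inc i e) => /=; last by rewrite big1.
  rewrite mulr_sumr big_mkcondr /=; apply: eq_bigr => f fG.
  by case: (inc i f) => //; rewrite mulrC.
rewrite exchange_big /=; apply: eq_bigr => e _.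
rewrite exchange_big /=; apply: eq_bigr => f _.
by rewrite mulr_sumr [RHS]big_mkcond.
Qed.

(** Expanding the square, the off-diagonal terms are controlled by the joint
probabilities and the diagonal ones by the first hypothesis on [K]; a small [K]
yields a small bound. *)
Lemma sum_incidence_sqr_le (I : finType) (w : I -> R)
    (inc : I -> {set V} -> bool) F (C K : R) : 0 <= C ->
  (forall e, e \in F -> p e * \sum_(i | inc i e) w i <= C * K) ->
  (forall e f, e \in F -> f \in F -> e != f ->
    \sum_(i | inc i e && inc i f) w i <=
    if (1 < #|e :&: f|)%N then C * c%:R ^+ #|e :&: f|.-1 else 0) ->
  \sum_i w i * (\sum_(e in F | inc i e) p e) ^+ 2 <=
  C * (K * expected_count F + overlap F F).
Proof.
move=> C0 diag off; under eq_bigr do rewrite expr2; rewrite sum_incidence.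
rewrite mulrDr /expected_count !mulr_sumr -big_split /=; apply: ler_sum => e eF.
rewrite (bigD1 e)//= lerD//.
  rewrite (eq_bigl (inc^~ e)); last by move=> i; rewrite andbb.
  rewrite -mulrA (_ : C * (K * p e) = p e * (C * K)); last by ring.
  by rewrite ler_wpM2l ?mono_prob_ge0// diag.
rewrite mulr_sumr [leRHS](eq_bigl (fun f => (f \in F) && (f != e) &&
  (1 < #|e :&: f|)%N)); last by move=> f; rewrite andbA.
rewrite [leRHS]big_mkcondr /=; apply: ler_sum => f /andP[fF fe].
apply: (le_trans (ler_wpM2l _ (off e f eF fF _))).
- by rewrite mulr_ge0 ?mono_prob_ge0.
- by rewrite eq_sym.
case: ifP => _; last by rewrite mulr0.
by rewrite /joint_prob mulrCA.
Qed.

(** For [1 < #|S| < m] this is the factor by which the joint probability of two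
hyperedges meeting exactly in [S] exceeds the product of their probabilities. *)
Definition size_weight (m : nat) (S : {set V}) : R :=
  if (1 < #|S| < m)%N then c%:R ^+ #|S|.-1 else 0.

Lemma size_weight_ge0 m S : 0 <= size_weight m S.
Proof. by rewrite /size_weight; case: ifP; rewrite ?exprn_ge0. Qed.

Lemma sum_size_weight_le m e :
  \sum_(S : {set V} | S \subset e) size_weight m S <=
  if (1 < #|e|)%N then 2 ^+ #|e| * c%:R ^+ (minn #|e| m.-1).-1 else 0.
Proof.
case: ifP => e1; last first.
  rewrite big1// => S /subset_leq_card Se; rewrite /size_weight.
  case: ifP => // /andP[S1 _]; by rewrite (leq_trans S1 Se) in e1.
rewrite (eq_bigl (fun S => S \in powerset e)); last by move=> S; rewrite powersetE.
apply: (@le_trans _ _ (\sum_(S in powerset e) c%:R ^+ (minn #|e| m.-1).-1)).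
  apply: ler_sum => S; rewrite powersetE => /subset_leq_card Se.
  rewrite /size_weight; case: ifP => [/andP[S1 Sm]|_]; last by rewrite exprn_ge0.
  rewrite ler_weXn2l//; have : (#|S| <= minn #|e| m.-1)%N.
    by rewrite leq_min Se -ltnS (ltn_predK Sm).
  by move/leq_sub2r => /(_ 1%N); rewrite !subn1.
by rewrite sumr_const card_powerset -[_ *+ (2 ^ _)]mulr_natl natrX.
Qed.

Lemma sum_size_weight_sqr_le m F a K : (forall e, e \in F -> #|e| = a) ->
  c%:R ^- a.-1 * c%:R ^+ (minn a m.-1).-1 <= K ->
  \sum_(S : {set V}) size_weight m S * (\sum_(e in F | S \subset e) p e) ^+ 2 <=
  2 ^+ a * (K * expected_count F + overlap F F).
Proof.
move=> Fa hK; have K0 : 0 <= K.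
  by apply: le_trans hK; rewrite mulr_ge0 ?invr_ge0 ?exprn_ge0.
apply: sum_incidence_sqr_le => [|e eF|e f eF fF _]; first by rewrite exprn_ge0.
  apply: (le_trans (ler_wpM2l (mono_prob_ge0 _ _ _) (sum_size_weight_le _ _))).
  rewrite /mono_prob Fa//; case: ifP => _; last first.
    by rewrite mulr0 mulr_ge0 ?exprn_ge0.
  by rewrite mulrCA ler_wpM2l ?exprn_ge0.
rewrite (eq_bigl (fun S => S \subset e :&: f)); last by move=> S; rewrite finset.subsetI.
apply: (le_trans (sum_size_weight_le _ _)); case: ifP => // _.
rewrite ler_pM ?exprn_ge0// ler_weXn2l//.
- by rewrite ler1n.
- by rewrite -(Fa _ eF) subset_leq_card ?finset.subsetIl.
- by rewrite -!subn1 leq_sub2r// geq_minl.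
Qed.

(** Each pair [e], [f] is accounted for by [S = e :&: f], of cardinality at most
[a < b], and Cauchy-Schwarz over [S] separates the two families.  On the side of
[G] only sets [S] smaller than the hyperedges occur, whence the factor
[c%:R^-1] in front of [expected_count G]. *)
Lemma overlap_cross F G a b : (1 < a < b)%N ->
  (forall e, e \in F -> #|e| = a) -> (forall e, e \in G -> #|e| = b) ->
  overlap F G <=
  Num.sqrt (2 ^+ a * (1 * expected_count F + overlap F F)) *
  Num.sqrt (2 ^+ b * (c%:R^-1 * expected_count G + overlap G G)).
Proof.
move=> /andP[a1 ab] Fa Gb.
have key : overlap F G <= \sum_(S : {set V}) size_weight b S *
    ((\sum_(e in F | S \subset e) p e) * (\sum_(e in G | S \subset e) p e)).
  rewrite sum_incidence; apply: ler_sum => e eF.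
  rewrite [leLHS]big_mkcondr /=; apply: ler_sum => f fG.
  have S0 : 0 <= \sum_(S : {set V} | (S \subset e) && (S \subset f)) size_weight b S.
    by apply: sumr_ge0 => S _; exact: size_weight_ge0.
  case: ifP => [/andP[_ s1]|_]; last by rewrite !mulr_ge0 ?mono_prob_ge0.
  rewrite /joint_prob ler_wpM2l ?mulr_ge0 ?mono_prob_ge0//.
  rewrite (bigD1 (e :&: f)) ?finset.subsetIl ?finset.subsetIr//= -[leLHS]addr0 lerD//.
    rewrite /size_weight s1 (leq_ltn_trans _ ab)//.
    by rewrite -(Fa _ eF) subset_leq_card ?finset.subsetIl.
  by apply: sumr_ge0 => S _; exact: size_weight_ge0.
apply: (le_trans key); apply: (le_trans (cauchy_schwarz_sum _ _ (size_weight_ge0 b))).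
rewrite ler_pM ?sqrtr_ge0// ler_wsqrtr// sum_size_weight_sqr_le//.
  have /minn_idPl -> : (a <= b.-1)%N by rewrite -ltnS (ltn_predK ab).
  by rewrite mulVf// expf_neq0// gt_eqF.
rewrite (minn_idPr _) ?leq_pred//.
case: b {ab Gb key} (leq_ltn_trans a1 ab) => [|[|[|b]]]// _ /=.
by rewrite exprS invfM -mulrA mulVf ?mulr1// expf_neq0// gt_eqF.
Qed.

(** * The cost of recoloring a hyperedge *)

Definition vertex_weight (E : {set {set V}}) v : R := \sum_(f in E | v \in f) p f.

Lemma vertex_weight_ge0 E v : 0 <= vertex_weight E v.
Proof. by apply: sumr_ge0 => f _; exact: mono_prob_ge0. Qed.

Lemma sum_vertex_weight E r : (forall e, e \in E -> (#|e| <= r)%N) ->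
  \sum_v vertex_weight E v <= r%:R * expected_count E.
Proof.
move=> Er; rewrite /vertex_weight (exchange_big_dep (mem E)) /=; last by move=> ? ? _ /andP[].
rewrite mulr_sumr; apply: ler_sum => e eE.
rewrite (eq_bigl (mem e)); last by move=> v; rewrite eE.
by rewrite sumr_const -[p e *+ _]mulr_natl ler_wpM2r ?mono_prob_ge0// ler_nat Er.
Qed.

Definition overlap_bound (E : {set {set V}}) (r : nat) : R :=
  Num.sqrt (r%:R ^+ 2 * (c%:R^-1 * expected_count E + overlap E E)) *
  (r%:R * expected_count E).

(** If [v] is a vertex of [e] other than the heaviest vertex [u], then its weight
is the minimum of the weights of [u] and [v].  Summing this minimum against the
weight of the hyperedges through both vertices over all pairs [u != v], and
bounding its square by the product of the two weights, Cauchy-Schwarz gives the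
product [overlap_bound]. *)
Lemma sum_other_vertex_weight E r (root : {set V} -> V) :
  (forall e, e \in E -> (1 < #|e| <= r)%N) ->
  (forall e, e \in E -> root e \in e) ->
  (forall e v, e \in E -> v \in e ->
     vertex_weight E v <= vertex_weight E (root e)) ->
  \sum_(e in E) p e * \sum_(v in e :\ root e) vertex_weight E v <=
  overlap_bound E r.
Proof.
move=> Er rootE rootmax; set D := vertex_weight E.
have D0 v : 0 <= D v by exact: vertex_weight_ge0.
pose w (z : V * V) : R := (z.1 != z.2)%:R.
pose inc (z : V * V) e := (z.1 \in e) && (z.2 \in e).
pose m (z : V * V) : R := Num.min (D z.1) (D z.2).
have w0 z : 0 <= w z by [].
have m0 z : 0 <= m z by rewrite le_min !D0.
have key : \sum_(e in E) p e * \sum_(v in e :\ root e) D v <=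
    \sum_z w z * ((\sum_(e in E | inc z e) p e) * m z).
  apply: (@le_trans _ _ (\sum_(e in E) \sum_(z | inc z e) w z * (p e * m z))).
    apply: ler_sum => e eE; rewrite mulr_sumr.
    rewrite (eq_bigl (fun z : V * V => (z.1 \in e) && (z.2 \in e)))//.
    rewrite -(pair_big (mem e) (mem e)
      (fun u v => w (u, v) * (p e * m (u, v))))/=.
    rewrite [leRHS](bigD1 (root e)) /=; last exact: rootE.
    rewrite -[leLHS]addr0 lerD//; last first.
      apply: sumr_ge0 => u _; apply: sumr_ge0 => v _.
      by rewrite !mulr_ge0 ?mono_prob_ge0.
    rewrite [leRHS](bigD1 (root e)) /=; last exact: rootE.
    rewrite /w eqxx mul0r add0r.
    rewrite [leRHS](eq_bigl (mem (e :\ root e))); last first.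
      by move=> v; rewrite !inE andbC.
    apply: ler_sum => v; rewrite !inE => /andP[vr ve].
    by rewrite eq_sym vr mul1r /m/= (min_idPr _)// rootmax.
  rewrite (exchange_big_dep predT)//=; apply: ler_sum => z _.
  by rewrite mulr_suml mulr_sumr.
apply: (le_trans key); apply: (le_trans (cauchy_schwarz_sum _ _ w0)).
have r0 e : e \in E -> (#|e| <= r)%N by move=> /Er/andP[].
have pairs (e : {set V}) : \sum_(z | inc z e) w z <=
    if (1 < #|e|)%N then #|e|%:R ^+ 2 else 0.
  rewrite (eq_bigl (fun z : V * V => (z.1 \in e) && (z.2 \in e)))//.
  rewrite -(pair_big (mem e) (mem e) (fun u v => w (u, v)))/=.
  case: ifP => e1.
    apply: (@le_trans _ _ (\sum_(u in e) \sum_(v in e) 1)).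
      by apply: ler_sum => u _; apply: ler_sum => v _; rewrite /w lern1 leq_b1.
    by rewrite !sumr_const -[_ *+ _ *+ _]mulr_natl expr2.
  rewrite big1// => u ue; rewrite big1// => v ve.
  have /card_le1P/(_ u ue) : (#|e| <= 1)%N by rewrite leqNgt e1.
  by move=> /(_ v); rewrite ve inE => /esym/eqP ->; rewrite /w /= eqxx.
rewrite /overlap_bound ler_pM ?sqrtr_ge0//.
  apply: ler_wsqrtr; apply: sum_incidence_sqr_le => [|e eE|e f eE fE _].
  - by rewrite exprn_ge0.
  - apply: (le_trans (ler_wpM2l (mono_prob_ge0 _ _ _) (pairs e))).
    have /andP[e1 er] := Er _ eE; rewrite e1 mulrC.
    by rewrite ler_pM ?mono_prob_ge0 ?exprn_ge0 ?mono_prob_leV// lerXn2r ?nnegrE// ler_nat.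
  rewrite (eq_bigl (inc^~ (e :&: f))); last by move=> z; rewrite /inc !inE andbACA.
  apply: (le_trans (pairs _)); case: ifP => // _.
  rewrite -[leLHS]mulr1 ler_pM ?exprn_ge0 ?exprn_ege1// lerXn2r ?nnegrE// ler_nat.
  by rewrite (leq_trans _ (r0 _ eE))// subset_leq_card ?finset.subsetIl.
apply: (@le_trans _ _ (Num.sqrt ((\sum_v D v) ^+ 2))).
  apply: ler_wsqrtr; rewrite expr2 big_distrlr pair_big /=; apply: ler_sum => z _.
  rewrite /w; case: (z.1 != z.2); last by rewrite mul0r mulr_ge0.
  by rewrite mul1r expr2 ler_pM// /m ge_min lexx ?orbT.
rewrite sqrtr_sqr ger0_norm; last exact: sumr_ge0.
exact: sum_vertex_weight.
Qed.

Definition stein_error E r : R :=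
  expected_count E / c%:R + (overlap_bound E r *+ 2 + overlap E E).

Lemma stein_error_ge0 E r : 0 <= stein_error E r.
Proof.
have EC0 := expected_count_ge0 E.
rewrite addr_ge0 ?divr_ge0 ?(ltW c0)// addr_ge0 ?overlap_ge0// mulrn_wge0//.
by rewrite mulr_ge0 ?sqrtr_ge0 ?mulr_ge0.
Qed.

(** The mean bounds the probability that recoloring [e] changes the status of
another hyperedge or that [e] was monochromatic before.  A hyperedge [f] contributes
[p e * p f + J e f], which is [2 * p e * p f] when [e] and [f] have a single
common vertex; that vertex is then not the root of [e]. *)
Lemma sum_recolor_change E r (root : {set V} -> V) :
  (forall e, e \in E -> (1 < #|e| <= r)%N) ->
  (forall e, e \in E -> root e \in e) ->
  (forall e v, e \in E -> v \in e ->
     vertex_weight E v <= vertex_weight E (root e)) ->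
  \sum_(e in E) p e * mean (fun x : {ffun V -> 'I_c} => (mono x e)%:R +
    \sum_(f in E | (f != e) && ~~ [disjoint e :\ root e & f])
      ((mono x f)%:R + (mono (recolor e (root e) x) f)%:R)) <=
  stein_error E r.
Proof.
move=> Er rootE rootmax; have cp : (0 < c)%N by exact: ltnW.
have E2 e : e \in E -> (1 < #|e|)%N by move=> /Er/andP[].
have E1 e : e \in E -> (0 < #|e|)%N by move=> /E2/ltnW.
apply: (@le_trans _ _ (\sum_(e in E) (p e ^+ 2 +
    ((p e * \sum_(v in e :\ root e) vertex_weight E v) *+ 2 +
     \sum_(f in E | (f != e) && (1 < #|e :&: f|)%N) J e f)))); last first.
  rewrite big_split lerD ?sum_mono_prob_sqr// big_split lerD2r /= sumrMnl.
  by rewrite ler_pMn2r// sum_other_vertex_weight.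
apply: ler_sum => e eE; rewrite meanD mulrDr mean_mono ?E1// expr2 lerD2l.
rewrite mean_sum mulr_sumr.
rewrite (eq_bigr (fun f => p e * p f + J e f)); last first.
  move=> f /andP[fE _]; rewrite meanD mulrDr mean_mono ?E1//; congr (_ + _).
  by rewrite -mean_mono2 ?E1// (mean_mono_recolor _ cp (rootE _ eE)).
apply: (@le_trans _ _ (\sum_(f in E | ~~ [disjoint e :\ root e & f])
    (p e * p f) *+ 2 + \sum_(f in E | (f != e) && (1 < #|e :&: f|)%N) J e f)).
  rewrite [leLHS]big_mkcondr [X in _ <= X + _]big_mkcondr.
  rewrite [X in _ <= _ + X]big_mkcondr -big_split /=; apply: ler_sum => f fE.
  have pp0 : 0 <= p e * p f by rewrite mulr_ge0 ?mono_prob_ge0.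
  have ppJ := mono_prob2_le_joint e f.
  case: (f != e) => /=; last by case: ifP => _; lra.
  case: ifP => _; case: ifP => s1; try lra.
  have -> : J e f = p e * p f.
    by move: s1; rewrite /joint_prob; case: #|_| => [|[|]]//; rewrite expr0 mulr1.
  lra.
rewrite lerD2r sumrMnl ler_pMn2r// -mulr_sumr ler_wpM2l ?mono_prob_ge0//.
rewrite /vertex_weight (exchange_big_dep (mem E)) /=; last by move=> ? ? _ /andP[].
rewrite [leLHS]big_mkcondr /=; apply: ler_sum => f fE.
case: ifP => [/pred0Pn[v /= /andP[ve vf]]|_]; last first.
  by apply: sumr_ge0 => v _; exact: mono_prob_ge0.
rewrite (bigD1 v) ?ve ?fE//= -[leLHS]addr0 lerD2l.
by apply: sumr_ge0 => w _; exact: mono_prob_ge0.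
Qed.

Lemma exists_heaviest_vertex E : E != finset.set0 ->
  (forall e, e \in E -> (0 < #|e|)%N) ->
  exists root : {set V} -> V, forall e, e \in E -> root e \in e /\
    forall v, v \in e -> vertex_weight E v <= vertex_weight E (root e).
Proof.
move=> /set0Pn[e0 e0E] E1; have /card_gt0P[v0 _] := E1 _ e0E.
apply: (@fin_all_exists _ _ (fun e u => e \in E -> u \in e /\
  forall v, v \in e -> vertex_weight E v <= vertex_weight E u)) => e.
have [/E1/card_gt0P[u ue]|_] := boolP (e \in E); last by exists v0.
by case: (arg_maxP (vertex_weight E) ue) => w we wmax; exists w.
Qed.

Section Layers.
Context (d : nat) (L : 'I_d -> {set {set V}}).
Implicit Types (k : {ffun 'I_d -> nat}) (i j : 'I_d).

Definition count_vec (x : {ffun V -> 'I_c}) : {ffun 'I_d -> nat} :=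
  [ffun i => (\sum_(e in L i) mono x e)%N].

Definition incr_at k i : {ffun 'I_d -> nat} := [ffun j => (k j + (j == i))%N].

Definition count_pmf k : R := mean (fun x => (count_vec x == k)%:R).

Notation U := (\bigcup_i L i)%SET.

Hypothesis L_disj : forall i j, i != j -> [disjoint L i & L j].

Lemma incr_at_inj i : injective (incr_at^~ i).
Proof.
move=> k l kl; apply/ffunP => j; move/ffunP/(_ j): kl; rewrite !ffunE.
exact: addIn.
Qed.

Lemma count_vec_recolor i e u x : e \in L i -> u \in e -> ~~ mono x e ->
  (forall f, f \in U -> f != e -> mono (recolor e u x) f = mono x f) ->
  count_vec (recolor e u x) = incr_at (count_vec x) i.
Proof.
move=> eL ue xe same; apply/ffunP => j; rewrite !ffunE.
have same' f : f \in L j -> f != e -> mono (recolor e u x) f = mono x f.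
  by move=> fL; apply: same; apply/bigcupP; exists j.
case: (eqVneq j i) => [ji|ji].
  rewrite ji in same' *; rewrite (bigD1 e)//= [in RHS](bigD1 e)//=.
  rewrite (mono_recolor _ ue) (negPf xe) add0n addnC; congr (_ + _)%N.
  by apply: eq_bigr => f /andP[fL fe]; rewrite same'.
rewrite addn0; apply: eq_bigr => f fL; rewrite same'//.
apply: contraTneq eL => <-; by rewrite (disjointFr (L_disj ji)).
Qed.

(** The product [(k i).+1%:R * count_pmf (incr_at k i)] is the mean of the [i]-th
count times the indicator that the count vector is [incr_at k i]; by size biasing
it is the sum over [e] in [L i] of [p e] times the probability that the count
vector after recoloring [e] is [incr_at k i].  When no hyperedge but [e] changes
its status and [e] was not monochromatic before, recoloring adds one to the
[i]-th count, so the last event means that the count vector was [k]. *)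
Lemma count_pmf_recursion r k i : (forall e, e \in U -> (1 < #|e| <= r)%N) ->
  `|(k i).+1%:R * count_pmf (incr_at k i) - expected_count (L i) * count_pmf k|
  <= stein_error U r.
Proof.
move=> Ur; have cp : (0 < c)%N by exact: ltnW.
have LU j : L j \subset U by exact: finset.bigcup_sup.
have size_bias : (k i).+1%:R * count_pmf (incr_at k i) = \sum_(e in L i)
    mean (fun x => (mono x e)%:R * (count_vec x == incr_at k i)%:R).
  rewrite -meanZ -mean_sum; apply: eq_mean => x.
  case: eqP => [xk|_]; last by rewrite mulr0 big1// => e _; rewrite mulr0.
  move/ffunP/(_ i): xk; rewrite !ffunE eqxx addn1 => <-.
  by rewrite mulr1 natr_sum; apply: eq_bigr => e _; rewrite mulr1.
have [U0|/exists_heaviest_vertex] := eqVneq U finset.set0.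
  have L0 : L i = finset.set0.
    by apply/eqP; rewrite -finset.subset0 -U0 LU.
  rewrite size_bias /expected_count L0 !big_set0 mul0r subr0 normr0.
  exact: stein_error_ge0.
case=> [e /Ur/andP[/ltnW]//|root rootP].
have rootL e : e \in L i -> root e \in e.
  by move=> eL; apply: (rootP e _).1; exact: (fintype.subsetP (LU i)).
rewrite size_bias /expected_count mulr_suml -sumrB.
apply: le_trans (sum_recolor_change Ur (fun e eU => (rootP e eU).1)
  (fun e v eU => (rootP e eU).2 v)).
apply: (le_trans (ler_norm_sum _ _ _)).
rewrite [leRHS](big_setID (L i)) /= (finset.setIidPr (LU i)).
rewrite -[leLHS]addr0 lerD//; last first.
  apply: sumr_ge0 => e _; rewrite mulr_ge0 ?mono_prob_ge0 ?mean_ge0// => x.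
  by rewrite addr_ge0// sumr_ge0// => f _; rewrite addr_ge0.
apply: ler_sum => e eL.
rewrite (mean_mono_recolor (fun x => (count_vec x == incr_at k i)%:R) cp (rootL _ eL)).
rewrite -mulrBr normrM ger0_norm ?mono_prob_ge0// ler_wpM2l ?mono_prob_ge0//.
rewrite -meanB ler_norml -mulN1r -meanZ; apply/andP.
set change := fun x => (mono x e)%:R + _.
suff h x : `|(count_vec (recolor e (root e) x) == incr_at k i)%:R -
    (count_vec x == k)%:R| <= change x.
  by split; apply: ler_mean => x; have := h x; rewrite ler_norml ?mulN1r => /andP[].
have change0 f : 0 <= (mono x f)%:R + (mono (recolor e (root e) x) f)%:R :> R.
  by rewrite addr_ge0.
have sum0 : 0 <= \sum_(f in U | (f != e) && ~~ [disjoint e :\ root e & f])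
      ((mono x f)%:R + (mono (recolor e (root e) x) f)%:R) :> R.
  by apply: sumr_ge0.
(* [change x] is a sum of indicators; if it is less than [1], all of them vanish. *)
have [chg|chg] := boolP (1 <= change x).
  apply: le_trans chg; rewrite ler_norml.
  by case: (_ == _); case: (_ == _) => /=; apply/andP; split; lra.
have xe : ~~ mono x e.
  by apply: contra chg; rewrite /change => ->; rewrite lerDl.
rewrite (@count_vec_recolor i)// ?rootL//.
  by rewrite (inj_eq (@incr_at_inj i)) subrr normr0 addr_ge0.
move=> f fU fe; have [dis|ndis] := boolP [disjoint e :\ root e & f].
  exact: recolor_mono_same.
apply: contraNeq chg => xf; rewrite /change (bigD1 f) /= ?fU ?fe//.
set a := (mono x f)%:R + _; have a1 : 1 <= a.
  by move: xf; rewrite /a; case: (mono x f); case: (mono _ f) => //= _; rewrite ?addr0 ?add0r.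
rewrite (le_trans a1)// addrCA lerDl addr_ge0//; exact: sumr_ge0.
Qed.

End Layers.
End Overlap.

Local Open Scope classical_set_scope.

(** * Discrete random variables *)

Section DiscreteVariable.
Context (R : realType) (dO : measure_display) (Omega : measurableType dO)
  (P : probability Omega R) (T : countType) (W : Omega -> T).
Hypothesis mW : forall t, measurable (W @^-1` [set t]).

Definition atom t : R := fine (P (W @^-1` [set t])).

Lemma measurable_preimage_countable (A : set T) : measurable (W @^-1` A).
Proof.
rewrite -[A]image_id -bigcup_imset1 preimage_bigcup bigcup_mkcond.
apply: countable_bigcupT_measurable => [|t]; first exact: countableP.
by case: ifP.
Qed.

Lemma integrable_discrete (f : T -> R) (M : R) : (forall t, `|f t| <= M) ->
  P.-integrable setT (EFin \o (f \o W)).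
Proof.
move=> fM; apply: measurable_bounded_integrable => //.
- by rewrite -ge0_fin_numE ?fin_num_measure.
- by move=> _ B _; rewrite setTI comp_preimage; exact: measurable_preimage_countable.
- exists M; split; first exact: num_real.
  by move=> y My w _; apply: (le_trans (fM _)); exact: ltW.
Qed.

Lemma expectation_discrete (f : T -> R) (M : R) : (forall t, `|f t| <= M) ->
  'E_P[f \o W]%E = (\int[P]_w f (W w))%:E.
Proof.
move=> fM; rewrite unlock fineK//; apply: integrable_fin_num => //.
exact: integrable_discrete fM.
Qed.

Lemma Rintegral_atom t : \int[P]_w (W w == t)%:R = atom t.
Proof.
rewrite /Rintegral /atom; congr fine.
rewrite -[RHS]mul1e -[in RHS](setIT (W @^-1` _)) mul1e.
rewrite -(integral_indic P measurableT (mW t)); apply: eq_integral => w _.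
rewrite indicE; congr (_%:R%:E); congr nat_of_bool.
by apply/eqP/idP => [<-|/set_mem//]; apply/mem_set.
Qed.

(** Outside the finitely many values [emb j] the integrand is bounded by [M],
and the remaining probability is [1 - \sum_j atom (emb j)]. *)
Lemma Rintegral_truncation (J : finType) (emb : J -> T) (f : T -> R) (M : R) :
  injective emb -> (forall t, `|f t| <= M) ->
  `|\int[P]_w f (W w) - \sum_j f (emb j) * atom (emb j)| <=
  M * (1 - \sum_j atom (emb j)).
Proof.
move=> embI fM.
have M0 w : 0 <= M := le_trans (normr_ge0 _) (fM (W w)).
pose h (t : T) : R := \sum_j (t == emb j)%:R.
pose g (t : T) : R := \sum_j f (emb j) * (t == emb j)%:R.
have dirac_le1 t j : `|(t == emb j)%:R| <= 1 :> R.
  by rewrite normr_nat lern1 leq_b1.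
have h01 t : 0 <= h t <= 1.
  rewrite sumr_ge0//= /h; have [[j ->]|nj] := pselect (exists j, t = emb j).
    rewrite (bigD1 j)//= eqxx big1 ?addr0// => i ij.
    by rewrite (inj_eq embI) eq_sym (negPf ij).
  by rewrite big1// => j _; case: eqP => // tj; case: nj; exists j.
have fg t : f t - g t = f t * (1 - h t).
  rewrite mulrBr mulr1 /g /h mulr_sumr; congr (_ - _); apply: eq_bigr => j _.
  by case: eqP => [->//|]; rewrite !mulr0.
have ind_int j : P.-integrable setT (EFin \o (fun w => (W w == emb j)%:R)).
  exact: (integrable_discrete (fun t => dirac_le1 t j)).
have sum_int (a : J -> R) :
    \int[P]_w (\sum_j a j * (W w == emb j)%:R) = \sum_j a j * atom (emb j).
  rewrite /Rintegral.
  under eq_integral do rewrite -sumEFin; rewrite /=.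
  rewrite integral_sum//; last first.
    move=> j; apply: (integrable_discrete (f := fun t => a j * (t == emb j)%:R)
      (M := `|a j|)) => t.
    by rewrite normrM ler_piMr.
  rewrite (eq_bigr (fun j => (a j * atom (emb j))%:E)) ?sumEFin// => j _.
  rewrite -Rintegral_atom -RintegralZl// /Rintegral fineK//.
  apply: integrable_fin_num => //.
  apply: (integrable_discrete (f := fun t => a j * (t == emb j)%:R)
      (M := `|a j|)) => t.
  by rewrite normrM ler_piMr.
have f_int := integrable_discrete fM.
have g_int : P.-integrable setT (EFin \o (g \o W)).
  apply: (@integrable_discrete _ (\sum_j `|f (emb j)|)) => t.
  apply: (le_trans (ler_norm_sum _ _ _)); apply: ler_sum => j _.
  by rewrite normrM ler_piMr.
have h_int : P.-integrable setT (EFin \o (h \o W)).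
  apply: (@integrable_discrete _ 1) => t; have /andP[h0 h1] := h01 t.
  by rewrite ger0_norm.
rewrite -(sum_int (f \o emb)) /= -RintegralB//.
have one_h : \int[P]_w (M * (1 - h (W w))) = M * (1 - \sum_j atom (emb j)).
  have one_int : P.-integrable setT (EFin \o (cst 1 : Omega -> R)).
    by apply: (@integrable_discrete (cst 1) 1) => t; rewrite normr1.
  rewrite RintegralZl//; last first.
    apply: (@integrable_discrete (fun t => 1 - h t) 1) => t.
    by have /andP[h0 h1] := h01 t; rewrite ger0_norm ?subr_ge0// lerBlDr lerDl.
  rewrite RintegralB//; congr (_ * (_ - _)).
    by have := expectation_cst P 1; rewrite unlock /Rintegral => ->.
  rewrite [RHS](eq_bigr (fun j => 1 * atom (emb j))); last by move=> j; rewrite mul1r.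
  rewrite -sum_int; apply: eq_Rintegral => w _.
  by apply: eq_bigr => j _; rewrite mul1r.
rewrite -one_h; apply: (le_trans (le_normr_Rintegral _ _)) => //.
  exact: (@integrableB _ _ _ _ _ measurableT (EFin \o (f \o W)) (EFin \o (g \o W))).
apply: le_Rintegral => //.
- apply: (@integrable_discrete (fun t => `|f t - g t|) M) => t.
  rewrite normr_id fg normrM; have /andP[h0 h1] := h01 t.
  rewrite -[leRHS]mulr1 ler_pM// ger0_norm ?subr_ge0// lerBlDr lerDl//.
- apply: (@integrable_discrete (fun t => M * (1 - h t)) `|M|) => t.
  rewrite normrM; have /andP[h0 h1] := h01 t.
  rewrite -[leRHS]mulr1 ler_pM// ger0_norm ?subr_ge0// lerBlDr lerDl//.
- move=> w _; rewrite -/(g (W w)) fg normrM; have /andP[h0 h1] := h01 (W w).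
  by rewrite (ger0_norm (x := 1 - _)) ?subr_ge0// ler_wpM2r ?subr_ge0.
Qed.

End DiscreteVariable.

Section DiscreteVector.
Context (R : realType) (dO : measure_display) (Omega : measurableType dO)
  (P : probability Omega R) (I : finType) (X : I -> {RV P >-> nat}).

(** Collecting finitely many variables into one with values in the countable
type [{ffun I -> nat}] makes every function of them measurable. *)
Definition joint_variable (w : Omega) : {ffun I -> nat} := [ffun i => X i w].

Lemma joint_variable_preimage (k : {ffun I -> nat}) :
  joint_variable @^-1` [set k] =
  \bigcap_(i in [set` [set: I]%SET]) (X i @^-1` [set k i]).
Proof.
apply/seteqP; split => w /= => [<- i _|wk]; first by rewrite /= ffunE.
by apply/ffunP => i; rewrite ffunE; apply: wk; rewrite /= inE.
Qed.

Lemma measurable_joint_variable k : measurable (joint_variable @^-1` [set k]).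
Proof.
rewrite joint_variable_preimage; apply: fin_bigcap_measurable => // i _.
exact: measurable_funPTI.
Qed.

Lemma atom_joint_variable : mutually_independent X ->
  forall k, atom P joint_variable k = \prod_i atom P (X i) (k i).
Proof.
move=> indep k; rewrite /atom joint_variable_preimage indep//.
rewrite (eq_bigr (fun i => (fine (P (X i @^-1` [set k i])))%:E)).
  by rewrite prodEFin; apply: eq_bigl => i; rewrite inE.
by move=> i _; rewrite fineK// fin_num_measure//; exact: measurable_funPTI.
Qed.

End DiscreteVector.

(** * Random colorings and the finite model *)

Section RandomColoring.
Context (R : realType) (dO : measure_display) (Omega : measurableType dO)
  (P : probability Omega R) (V : finType) (c : nat) (X : V -> {RV P >-> nat}).
Hypotheses (c_gt0 : (0 < c)%N) (X_coloring : uniform_random_coloring c X).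

(** The colors are [1, ..., c], whereas ['I_c] starts at [0]. *)
Definition shift_coloring (x : {ffun V -> 'I_c}) : {ffun V -> nat} :=
  [ffun v => (x v).+1].

Lemma shift_coloring_inj : injective shift_coloring.
Proof.
move=> x y xy; apply/ffunP => v; move/ffunP/(_ v): xy; rewrite !ffunE.
by move=> [] /val_inj.
Qed.

Lemma atom_coloring x : atom P (joint_variable X) (shift_coloring x) = c%:R ^- #|V|.
Proof.
have [unif indep] := X_coloring; rewrite atom_joint_variable//.
rewrite (eq_bigr (fun=> c%:R^-1)) => [|v _]; first by rewrite prodr_const exprVn.
have := unif v (x v).+1; rewrite /distribution /pushforward /atom ffunE => ->.
by rewrite ltnS leq0n ltn_ord.
Qed.

(** The images of the [c ^ #|V|] colorings carry the total mass [1], so the error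
term of [Rintegral_truncation] vanishes. *)
Lemma Rintegral_coloring (f : {ffun V -> nat} -> R) (M : R) : (forall t, `|f t| <= M) ->
  \int[P]_w f (joint_variable X w) = mean (fun x => f (shift_coloring x)).
Proof.
move=> fM; have mX := measurable_joint_variable X.
have := Rintegral_truncation P mX shift_coloring_inj fM.
rewrite (eq_bigr (fun x => f (shift_coloring x) * c%:R ^- #|V|)); last first.
  by move=> x _; rewrite atom_coloring.
rewrite -mulr_suml mulrC -/(mean _).
under eq_bigr do rewrite atom_coloring.
have -> : \sum_(x : {ffun V -> 'I_c}) c%:R ^- #|V| = 1 :> R.
  transitivity (mean (fun=> 1 : R) (V := V) (c := c)); last exact: mean_const.
  by rewrite /mean mulr_sumr; apply: eq_bigr => x _; rewrite mulr1.
by rewrite subrr mulr0 normr_le0 subr_eq0 => /eqP.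
Qed.

Lemma eq_monochromatic (x y : V -> nat) e : x =1 y -> monochromatic x e = monochromatic y e.
Proof. by move=> /funext ->. Qed.

Section Count.
Context (E : {set {set V}}).

Definition count_of (t : {ffun V -> nat}) : R :=
  \sum_(e in E) (monochromatic t e)%:R.

Lemma count_of_shift x : count_of (shift_coloring x) = \sum_(e in E) (mono x e)%:R.
Proof.
apply: eq_bigr => e _; congr (_%:R); congr nat_of_bool.
by apply: eq_monochromatic => v; rewrite ffunE.
Qed.

Lemma count_of_bound a t : `|count_of t - a| <= #|E|%:R + `|a|.
Proof.
rewrite (le_trans (ler_normB _ _))// lerD2r ger0_norm ?sumr_ge0//.
rewrite -sum1_card natr_sum; apply: ler_sum => e _.
by rewrite lern1 leq_b1.
Qed.

Lemma expectation_count (T : Omega -> R) : (1 < c)%N ->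
  (forall e, e \in E -> (1 < #|e|)%N) ->
  (forall w, T w = count_of (joint_variable X w)) ->
  'E_P[T]%E = (expected_count R c E)%:E.
Proof.
move=> c1 E2 /funext ->.
have b t : `|count_of t| <= #|E|%:R + `|0 : R|.
  by have := count_of_bound 0 t; rewrite subr0.
rewrite (expectation_discrete P (measurable_joint_variable X) b).
rewrite (Rintegral_coloring b); congr (_%:E).
rewrite (eq_mean count_of_shift) mean_sum; apply: eq_bigr => e eE.
by rewrite mean_mono// ltnW// E2.
Qed.

Lemma variance_count (T : Omega -> R) : (1 < c)%N ->
  (forall e, e \in E -> (1 < #|e|)%N) ->
  (forall w, T w = count_of (joint_variable X w)) ->
  'V_P[T]%E = (mean (fun x : {ffun V -> 'I_c} =>
    (\sum_(e in E) (mono x e)%:R - expected_count R c E) ^+ 2))%:E.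
Proof.
move=> c1 E2 Tw; rewrite /variance unlock (expectation_count c1 E2 Tw) /=.
set m := expected_count R c E; rewrite (_ : _ * _ =
    (fun t => (count_of t - m) ^+ 2) \o joint_variable X)%R; last first.
  by apply/funext => w /=; rewrite fctE /= Tw expr2.
have b t : `|(count_of t - m) ^+ 2| <= (#|E|%:R + `|m|) ^+ 2.
  by rewrite normrX lerXn2r ?nnegrE ?addr_ge0// count_of_bound.
rewrite (expectation_discrete P (measurable_joint_variable X) b).
rewrite (Rintegral_coloring b); congr (_%:E).
by apply: eq_mean => x; rewrite count_of_shift.
Qed.

End Count.
End RandomColoring.

(** * Count vectors and Poisson weights *)

Section Box.
Context (d K : nat).

Definition box (l : {ffun 'I_d -> 'I_K.+1}) : {ffun 'I_d -> nat} :=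
  [ffun i => l i : nat].

Lemma box_inj : injective box.
Proof.
move=> l l' ll'; apply/ffunP => i; move/ffunP/(_ i): ll'; rewrite !ffunE.
exact: val_inj.
Qed.

Lemma sum_indicator_box (R : realType) (k : {ffun 'I_d -> nat}) :
  \sum_l (k == box l)%:R = [forall i, (k i <= K)%N]%:R :> R.
Proof.
case: (boolP [forall i, (k i <= K)%N]) => [/forallP kK|/forallPn[i ki]].
  have kE : k = box [ffun i => inord (k i)].
    by apply/ffunP => i; rewrite !ffunE inordK// ltnS.
  rewrite (bigD1 [ffun i => inord (k i)])//= -kE eqxx big1 ?addr0// => l lk.
  by rewrite {1}kE (inj_eq box_inj) eq_sym (negPf lk).
rewrite big1// => l _; case: eqP => // kE; move: ki.
by rewrite kE ffunE -ltnS ltn_ord.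
Qed.

End Box.

Section CountPmf.
Context (R : realType) (V : finType) (c d : nat) (L : 'I_d -> {set {set V}}).
Hypothesis c_gt0 : (0 < c)%N.

Lemma count_pmf_ge0 k : 0 <= count_pmf R c L k.
Proof. by apply: mean_ge0. Qed.

Lemma count_pmf_le1 k : count_pmf R c L k <= 1.
Proof.
rewrite -[leRHS](mean_const V _ c_gt0); apply: ler_mean => x.
by rewrite lern1 leq_b1.
Qed.

Lemma sum_count_pmf_box K : \sum_(l : {ffun 'I_d -> 'I_K.+1})
    count_pmf R c L (box l) =
  mean (fun x : {ffun V -> 'I_c} => [forall i, (count_vec L x i <= K)%N]%:R).
Proof.
by rewrite -mean_sum; apply: eq_mean => x; exact: sum_indicator_box.
Qed.

Lemma sum_count_pmf_box_le1 K :
  \sum_(l : {ffun 'I_d -> 'I_K.+1}) count_pmf R c L (box l) <= 1.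
Proof.
rewrite sum_count_pmf_box -[leRHS](mean_const V _ c_gt0); apply: ler_mean => x.
by rewrite lern1 leq_b1.
Qed.

(** Markov's inequality: outside the box some count is at least [K.+1], hence so
is their sum. *)
Lemma count_pmf_tail K : (forall i e, e \in L i -> (0 < #|e|)%N) ->
  1 - \sum_(l : {ffun 'I_d -> 'I_K.+1}) count_pmf R c L (box l) <=
  (\sum_i expected_count R c (L i)) / K.+1%:R.
Proof.
move=> L0; rewrite sum_count_pmf_box -{1}(mean_const V (1 : R) c_gt0) -meanB.
have -> : (\sum_i expected_count R c (L i)) / K.+1%:R =
    mean (fun x : {ffun V -> 'I_c} => K.+1%:R^-1 * \sum_i (count_vec L x i)%:R).
  rewrite meanZ mulrC mean_sum; congr (_ * _); apply: eq_bigr => i _.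
  rewrite (eq_mean (psi := fun x => \sum_(e in L i) (mono x e)%:R)).
    rewrite mean_sum; apply: eq_bigr => e eL; by rewrite mean_mono// (L0 i).
  by move=> x; rewrite ffunE natr_sum.
apply: ler_mean => x; have S0 : 0 <= \sum_i (count_vec L x i)%:R :> R by exact: sumr_ge0.
case: (boolP [forall i, _]) => [_|/forallPn[i]]; first by rewrite subrr mulr_ge0.
rewrite -ltnNge subr0 => Ki; rewrite mulrC ler_pdivlMr// mul1r (bigD1 i)//=.
by rewrite -[leLHS]addr0 lerD ?ler_nat// sumr_ge0.
Qed.

End CountPmf.

Section LayerCounts.
Context (R : realType) (dO : measure_display) (Omega : measurableType dO)
  (P : probability Omega R) (V : finType) (c d : nat) (X : V -> {RV P >-> nat})
  (L : 'I_d -> {set {set V}}).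

Definition layer_counts (t : {ffun V -> nat}) : {ffun 'I_d -> nat} :=
  [ffun i => (\sum_(e in L i) monochromatic t e)%N].

Lemma measurable_layer_counts k :
  measurable ((layer_counts \o joint_variable X) @^-1` [set k]).
Proof.
rewrite comp_preimage; apply: measurable_preimage_countable.
exact: measurable_joint_variable.
Qed.

Lemma atom_layer_counts k : (0 < c)%N -> uniform_random_coloring c X ->
  atom P (layer_counts \o joint_variable X) k = count_pmf R c L k.
Proof.
move=> c0 Xc; rewrite -(Rintegral_atom P measurable_layer_counts).
rewrite (Rintegral_coloring (f := fun t => (layer_counts t == k)%:R) (M := 1) c0 Xc).
  apply: eq_mean => x; congr (_%:R); congr nat_of_bool; congr (_ == _).
  apply/ffunP => i; rewrite !ffunE; apply: eq_bigr => e _; congr nat_of_bool.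
  by apply: eq_monochromatic => v; rewrite ffunE.
by move=> t; rewrite normr_nat lern1 leq_b1.
Qed.

End LayerCounts.

Section Poisson.
Context (R : realType).

(** The case [lambda = 0], where the law is the Dirac mass at [0], agrees with
the general formula because [0 ^+ 0 = 1]. *)
Lemma atom_poisson (dO : measure_display) (Omega : measurableType dO)
    (P : probability Omega R) (lambda : R) (Z : {RV P >-> nat}) k :
  0 <= lambda -> poisson_distributed lambda Z ->
  atom P Z k = lambda ^+ k / k`!%:R * expR (- lambda).
Proof.
rewrite le_eqVlt => /predU1P[<-|l0] /(congr1 (fun f => fine (f [set k])));
  rewrite /distribution /pushforward /poisson_prob /atom => ->.
  rewrite ltxx [X in fine X]diracE oppr0 expR0 mulr1 /=.
  case: k => [|k]; first by rewrite mem_set//= expr0 fact0 divr1.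
  by rewrite memNset//= expr0n mul0r.
rewrite l0 esum_set1 ?lee_fin ?poisson_pmf_ge0//=.
by rewrite /poisson_pmf l0.
Qed.

(** The density of independent Poisson variables at [k], without the normalizing
factor [\prod_i expR (- lambda i)]. *)
Definition poisson_weight (d : nat) (lambda : 'I_d -> R) (k : {ffun 'I_d -> nat}) : R :=
  \prod_i (lambda i ^+ k i / (k i)`!%:R).

Lemma sum_poisson_weight_box (d : nat) (lambda : 'I_d -> R) :
  \sum_(l : {ffun 'I_d -> 'I_K.+1}) poisson_weight lambda (box l) @[K --> \oo] -->
  \prod_i expR (lambda i).
Proof.
rewrite [X in X @ _ --> _](_ : _ = fun K =>
    \prod_i \sum_(0 <= k < K.+1) exp_coeff (lambda i) k); last first.
  apply/funext => K; under [RHS]eq_bigr do rewrite big_mkord.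
  rewrite bigA_distr_bigA; apply: eq_bigr => l _; apply: eq_bigr => i _.
  by rewrite ffunE /exp_coeff /=.
apply: (cvg_big (@mul_continuous R)) => i _.
have : series (exp_coeff (lambda i)) K @[K --> \oo] --> expR (lambda i).
  exact: is_cvg_series_exp_coeff.
by rewrite -(cvg_shiftS (series (exp_coeff (lambda i)))).
Qed.

End Poisson.
(** * Limits of solutions of the approximate recursion *)

Lemma cvg_sumr (R : realType) (I : finType) (A : pred I) (f : I -> nat -> R) (l : I -> R) :
  (forall i, A i -> f i n @[n --> \oo] --> l i) ->
  \sum_(i | A i) f i n @[n --> \oo] --> \sum_(i | A i) l i.
Proof. by move=> fl; apply: (cvg_big (@add_continuous R)) => i; exact: fl. Qed.

Lemma cvg_sqrt0 (R : realType) (f : nat -> R) :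
  f n @[n --> \oo] --> (0 : R) -> Num.sqrt (f n) @[n --> \oo] --> (0 : R).
Proof.
by move=> f0; rewrite -[X in _ --> X](@sqrtr0 R);
  exact: (continuous_cvg _ (@sqrt_continuous R 0)).
Qed.

Section PoissonRecursion.
Context (R : realType) (d : nat) (lambda : 'I_d -> R).
Context (q : nat -> {ffun 'I_d -> nat} -> R) (m : nat -> 'I_d -> R).
Implicit Types (k : {ffun 'I_d -> nat}) (i : 'I_d).
Hypothesis q_ge0 : forall k, \forall n \near \oo, 0 <= q n k <= 1.
Hypothesis m_cvg : forall i, m n i @[n --> \oo] --> lambda i.
Hypothesis q_rec : forall k i,
  (k i).+1%:R * q n (incr_at k i) - m n i * q n k @[n --> \oo] --> (0 : R).

Let w := poisson_weight lambda.

Lemma poisson_weight_incr k i :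
  w (incr_at k i) = lambda i / (k i).+1%:R * w k.
Proof.
rewrite /w /poisson_weight (bigD1 i)//= [in RHS](bigD1 i)//= mulrA.
rewrite ffunE eqxx addn1; congr (_ * _).
  rewrite exprS factS natrM invfM; ring.
by apply: eq_bigr => j ji; rewrite ffunE (negPf ji) addn0.
Qed.

(** Induction on the sum of the entries of [k]: the weights satisfy the recursion
exactly, with [lambda] in place of [m n]. *)
Lemma pmf_near_weight k :
  q n k - q n [ffun=> 0%N] * w k @[n --> \oo] --> (0 : R).
Proof.
have [N] := ubnP (\sum_i k i); elim: N k => // N IH k.
have [/existsP[i ki]|k0] := boolP [exists i, (0 < k i)%N]; last first.
  have -> : k = [ffun=> 0%N].
    apply/ffunP => i; rewrite ffunE; apply/eqP; rewrite -leqn0 leqNgt.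
    by move: k0; rewrite negb_exists => /forallP.
  move=> _; rewrite /w /poisson_weight big1 => [|i _]; last first.
    by rewrite ffunE expr0 fact0 divr1.
  rewrite [X in X @ _ --> _](_ : _ = cst 0); first exact: cvg_cst.
  by apply/funext => n; rewrite mulr1 subrr.
(* [k'] is [k] lowered by one at an index [i] with [0 < k i]. *)
pose k' : {ffun 'I_d -> nat} := [ffun j => (k j - (j == i))%N].
have kE : k = incr_at k' i.
  apply/ffunP => j; rewrite !ffunE; case: eqVneq => [->|_]; last by rewrite subn0 addn0.
  by rewrite subnK.
rewrite kE => sk; have {}sk : (\sum_j k' j < N)%N.
  move: sk; rewrite (eq_bigr (fun j => k' j + (j == i))%N); last first.
    by move=> j _; rewrite [LHS]ffunE.
  rewrite big_split /= addnC (bigD1 i)//= eqxx big1 ?addn0 ?add1n ?ltnS//.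
  by move=> j /negPf ->.
have a0 : (k' i).+1%:R != 0 :> R by rewrite pnatr_eq0.
have mq : (m n i - lambda i) * q n k' @[n --> \oo] --> (0 : R).
  apply: norm_cvg0; apply: (@squeeze_cvgr _ _ _ _ (cst 0) (fun n => `|m n i - lambda i|)).
  - have := q_ge0 k'; apply: filterS => n /andP[q0 q1] /=.
    by rewrite normr_ge0/= normrM (ger0_norm q0) ler_piMr.
  - exact: cvg_cst.
  - rewrite -(@normr0 _ R); apply: cvg_norm; rewrite -(subrr (lambda i)).
    by apply: cvgB; [exact: m_cvg|exact: cvg_cst].
rewrite [X in X @ _ --> _](_ : _ = fun n => (k' i).+1%:R^-1 *
    (((k' i).+1%:R * q n (incr_at k' i) - m n i * q n k') +
     ((m n i - lambda i) * q n k' +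
      lambda i * (q n k' - q n [ffun=> 0%N] * w k')))); last first.
  apply/funext => n; rewrite poisson_weight_incr.
  by field.
rewrite -[X in _ --> X](mulr0 (k' i).+1%:R^-1).
apply: cvgM; first exact: cvg_cst.
rewrite -[X in _ --> X](addr0 0); apply: cvgD; first exact: q_rec.
rewrite -[X in _ --> X](addr0 0); apply: cvgD => //.
rewrite -[X in _ --> X](mulr0 (lambda i)).
by apply: cvgM; [exact: cvg_cst|exact: IH].
Qed.

Hypothesis q_tail : forall K, \forall n \near \oo,
  0 <= 1 - \sum_(l : {ffun 'I_d -> 'I_K.+1}) q n (box l) <= (\sum_i m n i) / K.+1%:R.

Let W := \prod_i expR (lambda i).

Lemma prod_expR_gt0 : 0 < W.
Proof. by apply: prodr_gt0 => i _; exact: expR_gt0. Qed.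

(** Summing [pmf_near_weight] over a box shows that [q n 0] times the sum of the
weights over the box is close to the mass of the box, and by [q_tail] this mass
is close to [1] when the box is large; the sum of the weights is then close to
[W]. *)
Lemma pmf0_cvg : q n [ffun=> 0%N] @[n --> \oo] --> W^-1.
Proof.
have W0 := prod_expR_gt0; set q0 := fun n => q n [ffun=> 0%N].
apply/cvgrPdist_le => e e0.
pose S K := \sum_(l : {ffun 'I_d -> 'I_K.+1}) w (box l).
pose M := \sum_i lambda i + 1.
have SW : `|W - S K| + `|M| / K.+1%:R @[K --> \oo] --> (0 : R).
  rewrite -[X in _ --> X](addr0 0); apply: cvgD.
    rewrite -(@normr0 _ R); apply: cvg_norm; rewrite -(subrr W).
    by apply: cvgB; [exact: cvg_cst|exact: sum_poisson_weight_box].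
  rewrite -[X in _ --> X](mulr0 `|M|); apply: cvgM; first exact: cvg_cst.
  exact: cvg_harmonic.
have /cvgrPdistC_le /(_ (e * W / 2)) := SW.
rewrite divr_gt0 ?mulr_gt0// => /(_ isT)[K _ /(_ K (leqnn K))] /=.
rewrite subr0 ger0_norm ?addr_ge0 ?divr_ge0// => hK.
have SK : \sum_(l : {ffun 'I_d -> 'I_K.+1}) q n (box l) - q0 n * S K
    @[n --> \oo] --> (0 : R).
  rewrite [X in X @ _ --> _](_ : _ = fun n => \sum_(l : {ffun 'I_d -> 'I_K.+1})
     (q n (box l) - q0 n * w (box l))); last first.
    by apply/funext => n; rewrite sumrB /S mulr_sumr.
  rewrite [X in _ --> X](_ : _ = \sum_(l : {ffun 'I_d -> 'I_K.+1}) 0); last first.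
    by rewrite big1.
  apply: cvg_sumr => l _; exact: pmf_near_weight.
have /cvgrPdistC_le /(_ (e * W / 2)) := SK.
rewrite divr_gt0 ?mulr_gt0// => /(_ isT) SKn.
have mM : \forall n \near \oo, \sum_i m n i <= M.
  have : \sum_i m n i @[n --> \oo] --> \sum_i lambda i by exact: cvg_sumr.
  move=> /cvgrPdistC_le /(_ 1 ltr01); apply: filterS => n.
  by rewrite ler_norml /M => /andP[_]; rewrite lerBlDl.
near=> n.
have h1 : `|\sum_(l : {ffun 'I_d -> 'I_K.+1}) q n (box l) - q0 n * S K - 0| <= e * W / 2.
  by near: n.
have h2 : \sum_i m n i <= M by near: n.
have /andP[h3 h4] : 0 <= 1 - \sum_(l : {ffun 'I_d -> 'I_K.+1}) q n (box l)
  <= (\sum_i m n i) / K.+1%:R by near: n; exact: q_tail.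
have /andP[h5 h6] : 0 <= q0 n <= 1 by near: n; exact: q_ge0.
rewrite -(ler_pM2r W0) -{2}(gtr0_norm W0) -normrM mulrBl mulVf ?gt_eqF//.
set Q := \sum_l q n (box l) in h1 h3 h4.
rewrite (_ : 1 - q0 n * W = (1 - Q) + (Q - q0 n * S K - 0) - q0 n * (W - S K)); last by ring.
apply: (le_trans (ler_normB _ _)); apply: (le_trans (lerD (ler_normD _ _) (lexx _))).
rewrite (ger0_norm h3) normrM (ger0_norm h5).
have h7 : q0 n * `|W - S K| <= `|W - S K| by rewrite ler_piMl.
have h8 : (\sum_i m n i) / K.+1%:R <= `|M| / K.+1%:R.
  by rewrite ler_wpM2r// (le_trans h2)// ler_norm.
have : e * W / 2 + e * W / 2 = e * W by rewrite -splitr.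
move: h1 h4 h7 h8 hK.
move: (e * W) (e * W / 2) (`|M| / K.+1%:R) `|W - S K| (q0 n * `|W - S K|)
  ((\sum_i m n i) / K.+1%:R) `|Q - q0 n * S K - 0|.
by move=> *; lra.
Unshelve. all: by end_near. Qed.

Lemma pmf_cvg k : q n k @[n --> \oo] --> w k / W.
Proof.
rewrite [X in X @ _ --> _](_ : _ = fun n => (q n k - q n [ffun=> 0%N] * w k) +
   w k * q n [ffun=> 0%N]); last by apply/funext => n; ring.
rewrite -[X in _ --> X](add0r (w k / W)).
apply: cvgD; first exact: pmf_near_weight.
by apply: cvgM; [exact: cvg_cst|exact: pmf0_cvg].
Qed.

End PoissonRecursion.
(** * Vanishing of the error terms *)

Section UnionOfLayers.
Context (R : realType) (V : finType) (c d : nat) (L : 'I_d -> {set {set V}}).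
Hypothesis L_disj : forall i j, i != j -> [disjoint L i & L j]%B.

Lemma expected_count_bigcup :
  expected_count R c (\bigcup_i L i)%SET = \sum_i expected_count R c (L i).
Proof. exact: partition_disjoint_bigcup. Qed.

Lemma overlap_bigcup :
  overlap R c (\bigcup_i L i)%SET (\bigcup_i L i)%SET =
  \sum_i \sum_j overlap R c (L i) (L j).
Proof.
rewrite /overlap partition_disjoint_bigcup//; apply: eq_bigr => i _.
rewrite exchange_big /=; apply: eq_bigr => e _.
rewrite big_mkcondr partition_disjoint_bigcup//=; apply: eq_bigr => j _.
by rewrite -big_mkcondr.
Qed.

End UnionOfLayers.

(** Distinct uniformities allow all the layers to be treated as a single family of sets. *)
Lemma layers_disjoint (V : finType) (d : nat) (r : 'I_d -> nat)
    (L : 'I_d -> {set {set V}}) : injective r ->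
  (forall i e, e \in L i -> #|e| = r i) ->
  forall i j, i != j -> [disjoint L i & L j]%B.
Proof.
move=> r_inj Lr i j ij; apply/pred0P => e /=; apply/negP => /andP[/Lr ei /Lr ej].
by move: ij; rewrite (r_inj i j) ?eqxx// -ei -ej.
Qed.

Section VanishingError.
Context (R : realType) (d : nat) (r : 'I_d -> nat) (V : nat -> finType)
  (L : forall n, 'I_d -> {set {set V n}}) (c : nat -> nat) (lambda : 'I_d -> R).
Hypotheses (r_ge2 : forall i, (1 < r i)%N) (r_inj : injective r)
  (L_size : forall n i e, e \in L n i -> #|e| = r i)
  (c_pinfty : c n @[n --> \oo] --> \oo).

Notation EC n i := (expected_count R (c n) (L n i)).
Notation A n i j := (overlap R (c n) (L n i) (L n j)).

Hypothesis EC_cvg : forall i, EC n i @[n --> \oo] --> lambda i.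
Hypothesis var_cvg : forall i,
  mean (fun x : {ffun V n -> 'I_(c n)} =>
    (\sum_(e in L n i) (mono x e)%:R - EC n i) ^+ 2) @[n --> \oo] --> lambda i.

Lemma near_colors_gt1 : \forall n \near \oo, (1 < c n)%N.
Proof. by move/cvgnyPge: c_pinfty => /(_ 2%N). Qed.

Lemma inv_colors_cvg0 : (c n)%:R^-1 @[n --> \oo] --> (0 : R).
Proof.
apply/gtr0_cvgV0; last exact/cvgrnyP.
have := near_colors_gt1; apply: filterS => n c1; by rewrite ltr0n ltnW.
Qed.

Let card_gt1 n i e : e \in L n i -> (1 < #|e|)%N.
Proof. by move/L_size ->. Qed.

(** By [variance_ge_overlap] the overlap is at most twice the difference of the
variance and the expected count, up to a term of order [1 / c]; both have the
limit [lambda i]. *)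
Lemma overlap_diag_cvg0 i : A n i i @[n --> \oo] --> (0 : R).
Proof.
apply: (@squeeze_cvgr _ _ _ _ (cst 0) (fun n => 2 *
  (mean (fun x : {ffun V n -> 'I_(c n)} =>
    (\sum_(e in L n i) (mono x e)%:R - EC n i) ^+ 2)
   - EC n i + EC n i * (c n)%:R^-1))).
- have := near_colors_gt1; apply: filterS => n c1; rewrite /= overlap_ge0/=.
  have := variance_ge_overlap R c1 (@card_gt1 n i); lra.
- exact: cvg_cst.
rewrite [X in _ --> X](_ : _ = 2 * (lambda i - lambda i + lambda i * 0)); last by ring.
apply: cvgM; first exact: cvg_cst.
by apply: cvgD; [exact: cvgB|apply: cvgM => //; exact: inv_colors_cvg0].
Qed.

(** In the bound of [overlap_cross] the first square root stays bounded and the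
second one tends to [0]. *)
Lemma overlap_cross_cvg0 i j : (r i < r j)%N -> A n i j @[n --> \oo] --> (0 : R).
Proof.
move=> rij.
apply: (@squeeze_cvgr _ _ _ _ (cst 0) (fun n =>
  Num.sqrt (2 ^+ r i * (1 * EC n i + A n i i)) *
  Num.sqrt (2 ^+ r j * ((c n)%:R^-1 * EC n j + A n j j)))).
- have := near_colors_gt1; apply: filterS => n c1; rewrite /= overlap_ge0/=.
  apply: overlap_cross => //; last by move=> e /L_size.
  + by rewrite r_ge2.
  + by move=> e /L_size.
- exact: cvg_cst.
rewrite -[X in _ --> X](mulr0 (Num.sqrt (2 ^+ r i * (1 * lambda i + 0)))).
apply: cvgM.
  apply: (continuous_cvg _ (@sqrt_continuous R _)).
  apply: cvgM; first exact: cvg_cst.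
  apply: cvgD; last exact: overlap_diag_cvg0.
  by apply: cvgM => //; exact: cvg_cst.
apply: cvg_sqrt0.
rewrite [X in _ --> X](_ : _ = 2 ^+ r j * (0 * lambda j + 0)); last by ring.
apply: cvgM; first exact: cvg_cst.
apply: cvgD; last exact: overlap_diag_cvg0.
by apply: cvgM => //; exact: inv_colors_cvg0.
Qed.

Lemma overlap_cvg0 i j : A n i j @[n --> \oo] --> (0 : R).
Proof.
have [rij|rji|/r_inj <-] := ltngtP (r i) (r j); last exact: overlap_diag_cvg0.
  exact: overlap_cross_cvg0.
rewrite [X in X @ _ --> _](_ : _ = fun n => A n j i); last first.
  by apply/funext => n; exact: overlapC.
exact: overlap_cross_cvg0.
Qed.

Let U n := (\bigcup_i L n i)%SET.

Let disj n := layers_disjoint r_inj (@L_size n).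

Lemma stein_error_cvg0 k : stein_error R (c n) (U n) k @[n --> \oo] --> (0 : R).
Proof.
have ECU : expected_count R (c n) (U n) @[n --> \oo] --> \sum_i lambda i.
  rewrite [X in X @ _ --> _](_ : _ = fun n => \sum_i EC n i); last first.
    by apply/funext => n; exact: (expected_count_bigcup _ _ (@disj n)).
  exact: cvg_sumr.
have AU : overlap R (c n) (U n) (U n) @[n --> \oo] --> (0 : R).
  rewrite [X in X @ _ --> _](_ : _ = fun n => \sum_i \sum_j A n i j); last first.
    by apply/funext => n; exact: (overlap_bigcup _ _ (@disj n)).
  have S0 : \sum_(i < d) \sum_(j < d) 0 = 0 :> R by rewrite big1// => i _; rewrite big1.
  rewrite -[X in _ --> X]S0; apply: cvg_sumr => i _; apply: cvg_sumr => j _.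
  exact: overlap_cvg0.
rewrite [X in _ --> X](_ : _ = (\sum_i lambda i) * 0 +
   ((0 * (k%:R * \sum_i lambda i)) *+ 2 + 0)); last by rewrite mul0r mulr0 mul0rn !addr0.
apply: cvgD; first by apply: cvgM => //; exact: inv_colors_cvg0.
apply: cvgD => //; apply: cvgMn; apply: cvgM; last by apply: cvgM => //; exact: cvg_cst.
apply: cvg_sqrt0.
rewrite [X in _ --> X](_ : _ = k%:R ^+ 2 * (0 * (\sum_i lambda i) + 0)); last by ring.
apply: cvgM; first exact: cvg_cst.
by apply: cvgD => //; apply: cvgM => //; exact: inv_colors_cvg0.
Qed.

Lemma count_pmf_cvg k : count_pmf R (c n) (L n) k @[n --> \oo] -->
  poisson_weight lambda k / \prod_i expR (lambda i).
Proof.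
apply: (pmf_cvg (q := fun n k => count_pmf R (c n) (L n) k)
  (m := fun n i => EC n i)) => //.
- move=> {}k; have := near_colors_gt1; apply: filterS => n c1.
  by rewrite count_pmf_ge0 count_pmf_le1// ltnW.
- move=> {}k i; pose rmax := (\max_i r i)%N; apply: norm_cvg0.
  apply: (@squeeze_cvgr _ _ _ _ (cst 0) (fun n => stein_error R (c n) (U n) rmax)).
  + have := near_colors_gt1; apply: filterS => n c1; rewrite normr_ge0/=.
    apply: count_pmf_recursion => //; first exact: disj.
    move=> e /bigcupP[j _ eL]; rewrite (card_gt1 eL) (L_size eL).
    exact: leq_bigmax.
  + exact: cvg_cst.
  + exact: stein_error_cvg0.
move=> K; have := near_colors_gt1; apply: filterS => n c1.
have c0 := ltnW c1; rewrite subr_ge0 sum_count_pmf_box_le1//=.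
by apply: count_pmf_tail => // i e /card_gt1/ltnW.
Qed.

End VanishingError.
(** * Convergence in distribution *)

(** Restrict both integrals to a large box by [Rintegral_truncation]: inside it
there are finitely many values, and since the limiting law has total mass [1]
the error is small for the limit, hence eventually also for [W n]. *)
Lemma Rintegral_cvg_atom (R : realType) (d : nat) (dO : nat -> measure_display)
    (Omega : forall n, measurableType (dO n))
    (P : forall n, probability (Omega n) R)
    (W : forall n, Omega n -> {ffun 'I_d -> nat})
    (dL : measure_display) (OmegaL : measurableType dL)
    (PL : probability OmegaL R) (WL : OmegaL -> {ffun 'I_d -> nat})
    (g : {ffun 'I_d -> nat} -> R) (M : R) :
  (forall n k, measurable (@W n @^-1` [set k])) ->
  (forall k, measurable (WL @^-1` [set k])) ->
  (forall k, atom (P n) (@W n) k @[n --> \oo] --> atom PL WL k) ->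
  \sum_(l : {ffun 'I_d -> 'I_K.+1}) atom PL WL (box l) @[K --> \oo] --> (1 : R) ->
  (forall k, `|g k| <= M) ->
  \int[P n]_w g (W n w) @[n --> \oo] --> \int[PL]_w g (WL w).
Proof.
move=> mW mWL cvgW mass gM; apply/cvgrPdist_le => e e0.
pose S K := \sum_(l : {ffun 'I_d -> 'I_K.+1}) atom PL WL (box l).
have tail : M * (1 - S K) + M * (1 - S K) @[K --> \oo] --> (0 : R).
  rewrite [X in _ --> X](_ : _ = M * (1 - 1) + M * (1 - 1)); last by ring.
  by apply: cvgD; apply: cvgM; do ?exact: cvg_cst; apply: cvgB => //; exact: cvg_cst.
have /cvgrPdistC_le/(_ (e / 2)) := tail.
rewrite divr_gt0// => /(_ isT)[K _ /(_ K (leqnn K))] /=.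
rewrite subr0 => /(le_trans (ler_norm _)) hK.
pose sL := \sum_(l : {ffun 'I_d -> 'I_K.+1}) g (box l) * atom PL WL (box l).
pose u n := M * (1 - \sum_(l : {ffun 'I_d -> 'I_K.+1}) atom (P n) (@W n) (box l)) +
  `|sL - \sum_(l : {ffun 'I_d -> 'I_K.+1}) g (box l) * atom (P n) (@W n) (box l)|.
have ucvg : u n @[n --> \oo] --> M * (1 - S K) + 0.
  apply: cvgD.
    apply: cvgM; first exact: cvg_cst.
    by apply: cvgB; [exact: cvg_cst|apply: cvg_sumr => l _; exact: cvgW].
  rewrite -[X in _ --> X](@normr0 _ R); apply: cvg_norm.
  rewrite -[X in _ --> X](subrr sL); apply: cvgB; first exact: cvg_cst.
  by apply: cvg_sumr => l _; apply: cvgM; [exact: cvg_cst|exact: cvgW].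
have /cvgrPdistC_le/(_ (e / 2)) := ucvg.
rewrite divr_gt0// => /(_ isT); apply: filterS => n.
rewrite addr0 => /(le_trans (ler_norm _)); rewrite lerBlDr /u => un.
have hn := Rintegral_truncation (P n) (mW n) (@box_inj d K) gM.
have hL := Rintegral_truncation PL mWL (@box_inj d K) gM.
move: hn hL hK un; rewrite -/(S K) -/sL.
move: (\int[PL]_w _) (\int[P n]_w _) => IL In.
set sn := \sum_l _ * _; move: (M * (1 - S K)) (M * _) => a b hn hL hK un.
have -> : IL - In = (IL - sL) + (sL - sn) - (In - sn) by ring.
apply: (le_trans (ler_normB _ _)); apply: (le_trans (lerD (ler_normD _ _) (lexx _))).
by move: hn hL hK un; move: `|In - sn| `|IL - sL| `|sL - sn| => *; lra.
Qed.

Lemma atom_joint_poisson (R : realType) (d : nat) (dL : measure_display)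
    (OmegaL : measurableType dL) (PL : probability OmegaL R)
    (lambda : 'I_d -> R) (Z : 'I_d -> {RV PL >-> nat}) k :
  (forall i, 0 <= lambda i) ->
  (forall i, poisson_distributed (lambda i) (Z i)) -> mutually_independent Z ->
  atom PL (joint_variable Z) k =
  poisson_weight lambda k / \prod_i expR (lambda i).
Proof.
move=> l0 Zp Zi; rewrite atom_joint_variable// /poisson_weight -prodfV -big_split.
by apply: eq_bigr => i _; rewrite (atom_poisson _ (l0 i))// expRN.
Qed.

Theorem mainTheorem5 (R : realType) (d : nat) (d_ge1 : (1 <= d)%N)
    (r : 'I_d -> nat) (r_ge2 : forall i, (2 <= r i)%N) (r_inj : injective r)
    (V : nat -> finType) (H : forall n, hypermultiplex (V n) r)
    (c : nat -> nat) (c_pinfty : c n @[n --> \oo] --> \oo)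
    (dO : nat -> measure_display) (Omega : forall n, measurableType (dO n))
    (P : forall n, probability (Omega n) R)
    (X : forall n, V n -> {RV (P n) >-> nat})
    (X_coloring : forall n, uniform_random_coloring (c n) (X n))
    (lambda : 'I_d -> R) (lambda_ge0 : forall i, 0 <= lambda i)
    (cvg_E : forall i,
       ('E_(P n)[monochromatic_count (H n i) (X n)] @[n --> \oo]
          --> (lambda i)%:E)%E)
    (cvg_V : forall i,
       ('V_(P n)[monochromatic_count (H n i) (X n)] @[n --> \oo]
          --> (lambda i)%:E)%E)
    (dL : measure_display) (OmegaL : measurableType dL)
    (PL : probability OmegaL R) (Z : 'I_d -> {RV PL >-> nat})
    (Z_poisson : forall i, poisson_distributed (lambda i) (Z i))
    (Z_indep : mutually_independent Z) :
  cvg_in_distribution P (fun n w => \col_i monochromatic_count (H n i) (X n) w)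
    PL (fun w => \col_i (Z i w)%:R).
Proof.
pose L n i := hyperedges (H n i).
have L_size n i e : e \in L n i -> #|e| = r i by exact: card_hyperedges.
have L_gt1 n i e : e \in L n i -> (1 < #|e|)%N by move=> /L_size ->; exact: r_ge2.
have near_c := near_colors_gt1 c_pinfty.
have countE n i w : monochromatic_count (H n i) (X n) w =
    count_of R (L n i) (joint_variable (X n) w).
  apply: eq_bigr => e _; congr (_%:R); congr nat_of_bool.
  by apply: eq_monochromatic => v; rewrite ffunE.
have EC_cvg i : expected_count R (c n) (L n i) @[n --> \oo] --> lambda i.
  apply: cvg_trans (fine_cvg (cvg_E i)); apply: near_eq_cvg.
  move: near_c; apply: filterS => n c1 /=.
  by rewrite (expectation_count (ltnW c1) (X_coloring n) c1 (@L_gt1 n i) (countE n i)).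
have var_cvg i : mean (fun x : {ffun V n -> 'I_(c n)} =>
    (\sum_(e in L n i) (mono x e)%:R - expected_count R (c n) (L n i)) ^+ 2)
    @[n --> \oo] --> lambda i.
  apply: cvg_trans (fine_cvg (cvg_V i)); apply: near_eq_cvg.
  move: near_c; apply: filterS => n c1 /=.
  by rewrite (variance_count (ltnW c1) (X_coloring n) c1 (@L_gt1 n i) (countE n i)).
pose W n := layer_counts (L n) \o joint_variable (X n).
pose col (k : {ffun 'I_d -> nat}) : 'cV[R]_d := \col_i (k i)%:R.
move=> f _ [M0 [_ /(_ (M0 + 1))]]; rewrite ltrDl => /(_ ltr01) fM.
have gM k : `|(f \o col) k| <= M0 + 1 by exact: fM.
have EW n : 'E_(P n)[f \o (fun w => \col_i monochromatic_count (H n i) (X n) w)]%E =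
    (\int[P n]_w (f \o col) (W n w))%:E.
  rewrite -(expectation_discrete (P n) (measurable_layer_counts (X n) (L n)) gM).
  congr expectation; apply/funext => w /=; congr f; apply/colP => i.
  by rewrite !mxE countE ffunE natr_sum.
have EZ : 'E_PL[f \o (fun w => \col_i (Z i w)%:R)]%E =
    (\int[PL]_w (f \o col) (joint_variable Z w))%:E.
  rewrite -(expectation_discrete PL (measurable_joint_variable Z) gM).
  by congr expectation; apply/funext => w /=; congr f; apply/colP => i; rewrite !mxE ffunE.
rewrite EZ; under eq_cvg do rewrite EW.
apply: cvg_EFin; first exact: nearW.
apply: Rintegral_cvg_atom gM.
- by move=> n k; exact: measurable_layer_counts.
- by move=> k; exact: measurable_joint_variable.
- move=> k; rewrite (atom_joint_poisson _ lambda_ge0)//.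
  apply: cvg_trans
    (count_pmf_cvg r_ge2 r_inj L_size c_pinfty EC_cvg var_cvg (k := k)).
  apply: near_eq_cvg; move: near_c; apply: filterS => n c1.
  by rewrite (atom_layer_counts _ _ (ltnW c1)).
have W0 := prod_expR_gt0 lambda.
rewrite [X in X @ _ --> _](_ : _ = fun K =>
    (\sum_(l : {ffun 'I_d -> 'I_K.+1}) poisson_weight lambda (box l)) *
    (\prod_i expR (lambda i))^-1); last first.
  apply/funext => K; rewrite mulr_suml; apply: eq_bigr => l _.
  exact: atom_joint_poisson.
rewrite -[X in _ --> X](mulfV (lt0r_neq0 W0)).
apply: cvgM; [exact: sum_poisson_weight_box|exact: cvg_cst].
Qed.
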